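(* Let $r \ge 3$ be a fixed integer and let $$\gamma_r = \max_{\alpha \in [0,1]} \left\{ \alpha^r (1-\alpha)^r + r \alpha^{r+1} (1-\alpha)^{r-1} \right\}.$$ If $\mathcal{A}, \mathcal{B} \subseteq [n]^{(r)}$ and the pair $(\mathcal{A}, \mathcal{B})$ is $2$-cross-avoiding, i.e. $|A \cap B| \ne 2$ for all $A \in \mathcal{A}$, $B \in \mathcal{B}$, then $$|\mathcal{A}||\mathcal{B}| \le (\gamma_r + o(1)) \binom{n}{r}^2 \quad \text{as } n \to \infty.$$ That is, for every $\varepsilon > 0$ there is $n_0 = n_0(r, \varepsilon)$ such that for all $n \ge n_0$ every $2$-cross-avoiding pair $(\mathcal{A}, \mathcal{B})$ with $\mathcal{A}, \mathcal{B} \subseteq [n]^{(r)}$ satisfies $|\mathcal{A}||\mathcal{B}| \le (\gamma_r + \varepsilon)\binom{n}{r}^2$.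
   Context: $[n] = \{1, \ldots, n\}$ and $[n]^{(r)}$ is the collection of all $r$-element subsets of $[n]$. *)

(* Defs.v *)
From mathcomp Require Import all_boot all_order all_algebra.
From mathcomp Require Import all_classical all_reals all_analysis.

Set Implicit Arguments.
Unset Strict Implicit.
Unset Printing Implicit Defensive.

Import Order.TTheory GRing.Theory Num.Theory.
Import numFieldTopology.Exports.

Local Open Scope ring_scope.

(* [n]^(r), where the ground set {1, ..., n} is represented by 'I_n. *)
Definition rsubsets (n r : nat) : {set {set 'I_n}} :=
  [set A : {set 'I_n} | #|A| == r].

Definition cross_avoiding (n t : nat) (F G : {set {set 'I_n}}) : Prop :=
  forall A B : {set 'I_n}, A \in F -> B \in G -> #|A :&: B| <> t.

Definition gamma_fun (R : realType) (r : nat) (a : R) : R :=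
  a ^+ r * (1 - a) ^+ r + r%:R * a ^+ r.+1 * (1 - a) ^+ r.-1.

(* The supremum is a maximum: see gamma_max. *)
Definition gamma (R : realType) (r : nat) : R :=
  sup [set gamma_fun r a | a in `[0, 1]]%classic.

Lemma gamma_max (R : realType) (r : nat) :
  exists2 c : R, c \in `[0, 1] &
    gamma R r = gamma_fun r c /\
    forall a, a \in `[0, 1] -> gamma_fun r a <= gamma_fun r c.
Proof.
have cf : continuous (gamma_fun r : R -> R).
  pose p : {poly R} :=
    'X ^+ r * (1 - 'X) ^+ r + r%:R%:P * 'X ^+ r.+1 * (1 - 'X) ^+ r.-1.
  have -> : gamma_fun r = horner p.
    by apply/funext => a; rewrite /gamma_fun /p !hornerE.
  exact: continuous_horner.
have [c c01 cmax] := EVT_max ler01 (continuous_subspaceT cf).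
exists c => //; split => //.
apply/eqP; rewrite eq_le; apply/andP; split.
  apply: ge_sup; first by exists (gamma_fun r c); exact: imageP.
  by move=> _ [a a01 <-]; exact: cmax.
apply: ub_le_sup; last exact: imageP.
by exists (gamma_fun r c) => _ [a a01 <-]; exact: cmax.
Qed.

(* Main.v *)
Require Import Defs.
From mathcomp Require Import all_boot all_order all_algebra.
From mathcomp Require Import all_classical all_reals all_analysis.
From mathcomp Require Import fintype finset perm.
From mathcomp Require Import zify ring lra.

(** Up to a negligible number of sets, avoiding intersections of size 2 forces
    all intersections to have size at most 1.  If some B in G contains a pair
    {x, y}, then every A in F through x and y meets B in a third point, so there
    are only O(n^(r-3)) such A.  Deleting from F the sets that contain a pair of
    such small codegree costs O(n^(r-1)) sets, and afterwards |A :&: B| <= 1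
    throughout ([remove_light_pairs]).

    The question is now about cliques against independent sets: the members of F
    are r-cliques of the graph formed by the pairs that they cover, and the
    members of G are independent in it.  Compressing F downwards and G upwards
    keeps the sizes and the intersection condition, so this graph may be taken
    to be a threshold graph ([exists_down_shifted], [threshold_cut]): a clique C
    on the first k vertices, an independent set I on the other l, and nested
    neighbourhoods between them.  The bipartite part is then a staircase.  With
    a = k / n, b = l / n, and the staircase seen as a monotone curve (u, v) from
    one corner of an a x b rectangle to the opposite one, the densities of F and
    G are at most a^r + r * int u^(r-1) dv and b^r + r * int v^(r-1) du
    ([threshold_count], [conjugate_moment]).

    The product of these two densities is at most gamma_r for every staircase
    ([staircase_bound]).  Each integral is linear in one coordinate and convex
    in the other, so that corners can be pushed along, one integral being
    constant and the other not decreasing, until the two integrals are those of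
    a staircase with one free level and one free corner ([chord_move],
    [staircase_two_steps]).  Such a staircase is dominated by one with a single
    corner, by a property of the S-shaped function 1 - (1 - e^m)^m
    ([one_corner_region]).  This leaves C together with one part of I joined to
    all of C and one part joined to none.  Varying |C| while the number of
    cliques is constant, the number of independent sets first decreases and then
    increases, so an extremal graph is a clique plus isolated vertices, or the
    complement of one ([three_block_bound]); these are the graphs whose product
    of densities is the function that gamma_r maximises. *)

Import Order.TTheory GRing.Theory Num.Theory.

Set Implicit Arguments.
Unset Strict Implicit.
Unset Printing Implicit Defensive.

(** * Reduction to intersections of size at most one *)

Lemma leq_ffact_expn n k : n ^_ k <= n ^ k.
Proof.
elim: k => [|k IHk]; first by rewrite ffactn0.
by rewrite ffactnSr expnSr leq_mul // leq_subr.
Qed.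

Lemma leq_bin_expn n k : 'C(n, k) <= n ^ k.
Proof.
apply: leq_trans (leq_ffact_expn n k).
by rewrite -bin_ffact leq_pmulr // fact_gt0.
Qed.

Lemma card_bigcup_le (I T : finType) (P : {pred I}) (B : I -> {set T}) :
  #|\bigcup_(i in P) B i| <= \sum_(i in P) #|B i|.
Proof.
elim/big_rec2: _ => [|i m A _ IH]; first by rewrite cards0.
by apply: leq_trans (leq_add (leqnn _) IH); rewrite -cardsUI leq_addr.
Qed.

Lemma card_supersets_le (T : finType) (S : {set T}) (r : nat) :
  #|[set A : {set T} | (S \subset A) && (#|A| == r)]| <= #|T| ^ (r - #|S|).
Proof.
apply: leq_trans (leq_bin_expn _ _).
rewrite -card_draws.
have inj : {in [set A : {set T} | (S \subset A) && (#|A| == r)] &,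
    injective (fun A => A :\: S)}.
  move=> A B; rewrite !inE => /andP[SA _] /andP[SB _] /= e.
  by rewrite -[LHS](setID _ S) -[RHS](setID _ S) [_ :\: _]e !(setIidPr _).
rewrite -(card_in_imset inj); apply: subset_leq_card; apply/subsetP => C.
move=> /imsetP[A]; rewrite inE => /andP[SA /eqP cA] ->; rewrite inE.
by rewrite cardsD (setIidPr SA) cA.
Qed.

Definition codegree (T : finType) (F : {set {set T}}) (x y : T) : nat :=
  #|[set A in F | (x \in A) && (y \in A)]|.

(** The cut-off r * #|T| ^ (r - 3) is the number of r-sets that contain x, y
    and some third point of a fixed r-set: a member of F through a pair inside B
    is of this kind, so no pair of larger codegree in F lies inside any B. *)
Lemma remove_light_pairs (T : finType) (r : nat) (F G : {set {set T}}) :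
  3 <= r ->
  (forall A, A \in F -> #|A| = r) -> (forall B, B \in G -> #|B| = r) ->
  (forall A B, A \in F -> B \in G -> #|A :&: B| <> 2) ->
  exists F' : {set {set T}}, [/\ F' \subset F,
    #|F| <= #|F'| + r * #|T| ^ r.-1 &
    forall A B, A \in F' -> B \in G -> #|A :&: B| <= 1].
Proof.
move=> r3 Fr Gr FG; pose K := r * #|T| ^ (r - 3).
pose light (p : T * T) := codegree F p.1 p.2 <= K.
pose bad := \bigcup_(p in [pred p | light p])
  [set A in F | (p.1 \in A) && (p.2 \in A)].
exists (F :\: bad); split; first exact: subsetDl.
- rewrite -[X in X <= _](cardsID bad F) addnC leq_add2l.
  apply: leq_trans (subset_leq_card (subsetIr _ _)) _.
  apply: leq_trans (card_bigcup_le _ _) _.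
  apply: (@leq_trans (\sum_(p : T * T) K)).
    rewrite [X in _ <= X](bigID [pred p | light p]) /=.
    apply: leq_trans (leq_addr _ _); apply: leq_sum => p; exact.
  rewrite sum_nat_const card_prod /K mulnCA leq_mul2l; apply/orP; right.
  rewrite -mulnA -!expnS leq_eqVlt; apply/orP; left; apply/eqP.
  by congr (_ ^ _); lia.
move=> A B; rewrite inE => /andP[Abad AF] BG; rewrite leqNgt; apply/negP.
move=> /card_gt1P[x [y [xAB yAB xy]]].
move: xAB yAB; rewrite !inE => /andP[xA xB] /andP[yA yB].
have : ~~ light (x, y).
  apply: contra Abad => xyl; apply/bigcupP; exists (x, y) => //.
  by rewrite inE AF xA yA.
apply/negP; rewrite negbK /light /codegree /=.
apply: (@leq_trans #|\bigcup_(z in B :\: [set x; y])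
   [set A : {set T} | ([set x; y; z] \subset A) && (#|A| == r)]|).
  apply: subset_leq_card; apply/subsetP => A'; rewrite inE.
  move=> /and3P[A'F xA' yA'].
  have sub2 : [set x; y] \subset A' :&: B.
    by apply/subsetP => z /set2P[]->; rewrite inE ?xA' ?yA'.
  (* the intersection contains x and y but does not have size 2 *)
  have : [set x; y] \proper A' :&: B.
    rewrite properEcard sub2 cards2 xy /=.
    have := subset_leq_card sub2; rewrite cards2 xy /= => h.
    by rewrite ltn_neqAle h andbT eq_sym; apply/eqP/FG.
  move=> /properP[_ [z]]; rewrite inE => /andP[zA' zB] zxy.
  apply/bigcupP; exists z; first by rewrite inE zxy.
  rewrite inE (Fr A' A'F) eqxx andbT; apply/subsetP => w.
  by rewrite !inE => /orP[/orP[]|] /eqP->.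
apply: leq_trans (card_bigcup_le _ _) _.
apply: (@leq_trans (\sum_(z in B :\: [set x; y]) #|T| ^ (r - 3))).
  apply: leq_sum => z; rewrite inE => /andP[zxy _].
  apply: leq_trans (card_supersets_le _ _) _.
  by rewrite [_ :|: [set z]]setUC cardsU1 zxy cards2 xy.
rewrite sum_nat_const leq_mul2r; apply/orP; right.
by rewrite -(Gr B BG) subset_leq_card // subsetDl.
Qed.

(** * Compression *)

(** A member of H either misses S or has exactly one point y in S, and then
    the rest of it is an m-subset of N y outside S. *)
Lemma card_star (T : finType) (H : {set {set T}}) (S : {set T})
    (N : T -> {set T}) (m : nat) :
  (forall A, A \in H -> #|A| = m.+1) ->
  (forall A x y, A \in H -> x \in A -> y \in A -> y \in S -> x != y ->
     x \in N y :\: S) ->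
  #|H| <= 'C(#|~: S|, m.+1) + \sum_(y in S) 'C(#|N y :\: S|, m).
Proof.
move=> Hm HN.
pose base := [set A : {set T} | (A \subset ~: S) && (#|A| == m.+1)].
pose star y := [set y |: A | A in
  [set A : {set T} | (A \subset N y :\: S) && (#|A| == m)]].
apply: (@leq_trans #|base :|: \bigcup_(y in S) star y|).
  apply: subset_leq_card; apply/subsetP => A AH; rewrite inE.
  have [dis|] := boolP [disjoint A & S].
    by rewrite inE -disjoints_subset dis Hm ?eqxx.
  move=> /pred0Pn[y /= /andP[yA yS]]; apply/orP; right.
  apply/bigcupP; exists y => //; apply/imsetP; exists (A :\ y).
    rewrite inE; apply/andP; split.
      by apply/subsetP => x; rewrite in_setD1 => /andP[xy xA]; exact: (HN A).
    by have := cardsD1 y A; rewrite yA Hm // add1n => -[->].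
  by rewrite setD1K.
rewrite -cards_draws; apply: leq_trans (leq_card_setU _ _) _.
rewrite leq_add2l; apply: leq_trans (card_bigcup_le _ _) _.
apply: leq_sum => y _; rewrite -cards_draws; exact: leq_imset_card.
Qed.

(** The compression that replaces j by i, seen as a map on F.  A set stays put
    when its image is already in F, which is what makes the map injective on F. *)
Definition shift (T : finType) (i j : T) (F : {set {set T}}) (A : {set T}) :=
  if [&& j \in A, i \notin A & tperm i j @: A \notin F] then tperm i j @: A
  else A.

Lemma tperm_setE (T : finType) (i j : T) (A : {set T}) :
  j \in A -> i \notin A -> tperm i j @: A = i |: A :\ j.
Proof.
move=> jA iA; apply/setP => x; rewrite !inE.
apply/imsetP/idP => [[y yA ->]|].
  case: tpermP => [yi|_|/eqP yi /eqP yj]; first by rewrite -yi yA in iA.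
    by rewrite eqxx.
  by rewrite yA yj orbT.
case/orP => [/eqP->|/andP[xj xA]]; first by exists j; rewrite ?tpermR.
exists x => //; rewrite tpermD // eq_sym //.
by apply: contraNneq iA => <-.
Qed.

Lemma tperm_imsetK (T : finType) (i j : T) :
  involutive (fun A : {set T} => tperm i j @: A).
Proof.
move=> A; apply/setP => x.
by rewrite -{1}(tpermK i j x) !(mem_imset _ _ (@perm_inj _ _)).
Qed.

Lemma tperm_set_id (T : finType) (i j : T) (A : {set T}) :
  (i \in A) = (j \in A) -> tperm i j @: A = A.
Proof.
move=> ij; apply/setP => x; rewrite -{1}(tpermK i j x) mem_imset; last exact: perm_inj.
by case: tpermP => [->|->|].
Qed.

Lemma card_tperm_setI (T : finType) (i j : T) (A B : {set T}) :
  #|(tperm i j @: A) :&: B| = #|A :&: (tperm i j @: B)|.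
Proof.
rewrite -[RHS](card_imset _ (@perm_inj _ (tperm i j))).
rewrite imsetI; last by move=> ? ? _ _; apply: perm_inj.
by rewrite tperm_imsetK.
Qed.

Lemma shift_inj (T : finType) (i j : T) (F : {set {set T}}) :
  {in F &, injective (shift i j F)}.
Proof.
move=> A B AF BF; rewrite /shift.
case: ifP => [/and3P[_ _ A1]|_]; case: ifP => [/and3P[_ _ B1]|_] // e.
- by apply: (can_inj (@tperm_imsetK T i j)).
- by rewrite e BF in A1.
- by rewrite -e AF in B1.
Qed.

(** The hypothesis on B says that B is fixed by the compression in the opposite
    direction.  If B misses i, then swapping does not enlarge the intersection;
    otherwise the swapped B is a member of G, and the swap can be transferred
    from A to B. *)
Lemma shift_cross_half (T : finType) (i j : T) (F G : {set {set T}})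
    (A B : {set T}) :
  (forall A B, A \in F -> B \in G -> #|A :&: B| <= 1) ->
  A \in F -> B \in G -> j \in A -> i \notin A ->
  ~~ [&& i \in B, j \notin B & tperm i j @: B \notin G] ->
  #|(tperm i j @: A) :&: B| <= 1.
Proof.
move=> FG AF BG jA iA; rewrite !negb_and !negbK.
have [iB|iB _] := boolP (i \in B); last first.
  apply: leq_trans (FG A B AF BG); apply: subset_leq_card.
  apply/subsetP => x; rewrite (tperm_setE jA iA) !inE => /andP[/orP[/eqP->|]].
    by rewrite (negPf iB).
  by move=> /andP[_ ->] ->.
rewrite card_tperm_setI /= => /orP[jB|]; last exact: FG.
by rewrite tperm_set_id ?iB ?jB //; apply: FG.
Qed.

(** The two families have to move in opposite directions: replacing G by the
    complements of its members, this is the classical fact that compression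
    preserves cross-t-intersecting families. *)
Lemma shift_cross (T : finType) (i j : T) (F G : {set {set T}}) :
  (forall A B, A \in F -> B \in G -> #|A :&: B| <= 1) ->
  forall A B, A \in shift i j F @: F -> B \in shift j i G @: G ->
  #|A :&: B| <= 1.
Proof.
move=> FG _ _ /imsetP[A AF ->] /imsetP[B BG ->]; rewrite /shift.
rewrite ![tperm j i]tpermC.
case: ifP => [/and3P[jA iA A1]|A1]; case: ifP => [/and3P[iB jB B1]|B1].
- by rewrite card_tperm_setI tperm_imsetK; apply: FG.
- by apply: shift_cross_half FG _ _ _ _ _; rewrite ?B1.
- rewrite setIC tpermC; apply: (@shift_cross_half _ j i G F) => //.
    by move=> ? ? ? ?; rewrite setIC; apply: FG.
  by rewrite tpermC A1.
- exact: FG.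
Qed.

Definition down_shifted (n : nat) (F : {set {set 'I_n}}) : Prop :=
  forall (A : {set 'I_n}) (i j : 'I_n), A \in F -> (i < j)%N ->
  j \in A -> i \notin A -> i |: A :\ j \in F.

Lemma card_tperm_set (T : finType) (i j : T) (A : {set T}) :
  #|tperm i j @: A| = #|A|.
Proof. by apply: card_imset; apply: perm_inj. Qed.

Lemma card_shift (T : finType) (i j : T) (F : {set {set T}}) (A : {set T}) :
  #|shift i j F A| = #|A|.
Proof. by rewrite /shift; case: ifP => // _; apply: card_tperm_set. Qed.

(** Among all pairs of families with the given sizes, take one in which the
    labels of the members of F have the least sum: a compression that moves a
    member of F would decrease that sum.  Only F needs to become stable, because
    G enters afterwards only through the pairs that F does not cover. *)
Lemma exists_down_shifted (n r : nat) (F G : {set {set 'I_n}}) :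
  (forall A, A \in F -> #|A| = r) -> (forall B, B \in G -> #|B| = r) ->
  (forall A B, A \in F -> B \in G -> #|A :&: B| <= 1) ->
  exists F' G' : {set {set 'I_n}},
    [/\ #|F'| = #|F|, #|G'| = #|G|,
      forall A, A \in F' -> #|A| = r, forall B, B \in G' -> #|B| = r &
      forall A B, A \in F' -> B \in G' -> #|A :&: B| <= 1] /\ down_shifted F'.
Proof.
move=> Fr Gr FG.
pose ok (p : {set {set 'I_n}} * {set {set 'I_n}}) :=
  [&& #|p.1| == #|F|, #|p.2| == #|G|, [forall A in p.1, #|A| == r],
    [forall B in p.2, #|B| == r] &
    [forall A in p.1, forall B in p.2, #|A :&: B| <= 1]].
pose wt (A : {set 'I_n}) := \sum_(a in A) (a : nat).
have okFG : ok (F, G).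
  rewrite /ok /= !eqxx /=; apply/and3P; split.
  - by apply/forall_inP => A /Fr->.
  - by apply/forall_inP => A /Gr->.
  - by apply/forall_inP => A AF; apply/forall_inP => B; apply: FG.
pose total (p : {set {set 'I_n}} * {set {set 'I_n}}) := \sum_(A in p.1) wt A.
case: (arg_minnP total okFG) => -[F' G'] /=.
rewrite /ok /= => /and5P[/eqP cF /eqP cG /forall_inP F'r /forall_inP G'r].
move=> /forall_inP F'G' min.
have FG' A B : A \in F' -> B \in G' -> #|A :&: B| <= 1.
  by move=> /F'G'/forall_inP; apply.
exists F', G'; split; first by split=> // A; [move/F'r/eqP|move/G'r/eqP].
move=> A i j AF ij jA iA; rewrite -(tperm_setE jA iA).
apply: contraT => AF1.
have okS : ok (shift i j F' @: F', shift j i G' @: G').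
  rewrite /ok /= !(card_in_imset (@shift_inj _ _ _ _)) cF cG !eqxx /=.
  apply/and3P; split.
  - by apply/forall_inP => _ /imsetP[B BF ->]; rewrite card_shift F'r.
  - by apply/forall_inP => _ /imsetP[B BF ->]; rewrite card_shift G'r.
  - apply/forall_inP => B BF; apply/forall_inP => B' BG.
    exact: shift_cross BF BG.
have := min _ okS; rewrite leqNgt => /negP[]; rewrite /total /=.
rewrite big_imset /=; last exact: shift_inj.
have wt_tperm (B : {set 'I_n}) : j \in B -> i \notin B -> wt (tperm i j @: B) < wt B.
  move=> jB iB; rewrite tperm_setE // /wt big_setU1; last first.
    by rewrite !inE negb_and iB orbT.
  by rewrite [X in _ < X](big_setD1 j) //= ltn_add2r.
rewrite (bigD1 A) //= [X in _ < X](bigD1 A) //= -addSn leq_add //.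
  by rewrite {1}/shift jA iA AF1 wt_tperm.
apply: leq_sum => B _; rewrite /shift; case: ifP => // /and3P[jB iB _].
exact/ltnW/wt_tperm.
Qed.

(** * Threshold graphs *)

Lemma card_ord_lt (n x : nat) : x <= n -> #|[set y : 'I_n | y < x]| = x.
Proof.
move=> xn; rewrite -[RHS]card_ord -!sum1_card (big_ord_widen n (fun=> 1) xn).
by apply: eq_bigl => y; rewrite inE.
Qed.

Lemma mem_down_closed (n : nat) (A : {set 'I_n}) :
  (forall i j : 'I_n, (i < j)%N -> j \in A -> i \in A) ->
  forall i : 'I_n, (i \in A) = (i < #|A|).
Proof.
move=> down i; apply/idP/idP => [iA|].
  rewrite -[X in X <= _](@card_ord_lt n i.+1) //; apply: subset_leq_card.
  apply/subsetP => j; rewrite inE ltnS leq_eqVlt => /orP[/eqP/ord_inj->//|].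
  by move/down; apply.
apply: contraTT => iA; rewrite -leqNgt -[X in _ <= X](@card_ord_lt n i); last exact: ltnW.
apply: subset_leq_card; apply/subsetP => j jA; rewrite inE ltnNge.
apply: contra iA; rewrite leq_eqVlt => /orP[/eqP/ord_inj->//|].
by move/down; apply.
Qed.

Definition shadow (T : finType) (F : {set {set T}}) : rel T :=
  fun x y => (x != y) && [exists A in F, (x \in A) && (y \in A)].

Lemma shadow_sym (T : finType) (F : {set {set T}}) : symmetric (shadow F).
Proof.
move=> x y; rewrite /shadow eq_sym; congr (_ && _).
by apply: eq_existsb => A; rewrite [(x \in A) && _]andbC.
Qed.

Lemma shadow_down (n : nat) (F : {set {set 'I_n}}) (i i' j : 'I_n) :
  down_shifted F -> shadow F i j -> (i' < i)%N -> i' != j -> shadow F i' j.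
Proof.
move=> dF /andP[ij /exists_inP[A AF /andP[iA jA]]] i'i i'j.
rewrite /shadow i'j; apply/exists_inP.
have [i'A|i'A] := boolP (i' \in A); first by exists A; rewrite ?i'A.
exists (i' |: A :\ i); first exact: dF.
by rewrite !inE eqxx [j == i]eq_sym ij jA !orbT.
Qed.

(** The cut k is the first vertex that is not adjacent to its successor.  Below
    it, i < j are adjacent because j - 1 and j are; above it, an adjacent pair
    could be lowered to the pair k, k + 1. *)
Lemma threshold_cut (n : nat) (F : {set {set 'I_n}}) : down_shifted F ->
  exists2 k, k <= n & forall i j : 'I_n, i != j ->
    ((i < k) && (j < k) -> shadow F i j) /\
    ((k <= i) && (k <= j) -> ~~ shadow F i j).
Proof.
move=> dF.
pose D x y := [exists i : 'I_n, exists j : 'I_n,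
  [&& (i : nat) == x, (j : nat) == y & shadow F i j]].
have Dn : exists k, ~~ D k k.+1.
  exists n; apply/negP => /existsP[i /existsP[j /and3P[/eqP e _ _]]].
  by have := ltn_ord i; rewrite e ltnn.
case: (ex_minnP Dn) => k kD kmin; exists k.
  apply: kmin; apply/negP => /existsP[i /existsP[j /and3P[/eqP e _ _]]].
  by have := ltn_ord i; rewrite e ltnn.
have clique (i j : 'I_n) : (i < j)%N -> (j < k)%N -> shadow F i j.
  move=> ij jk; have : D j.-1 j.-1.+1.
    by apply: contraT => /kmin; lia.
  move=> /existsP[i' /existsP[j' /and3P[/eqP ei /eqP ej sh]]].
  have jj' : j' = j by apply: ord_inj; rewrite ej; lia.
  rewrite jj' in sh; have [ii'|ii'] := eqVneq i i'; first by rewrite ii'.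
  apply: shadow_down dF sh _ _; last by rewrite -val_eqE /=; lia.
  by move: ii'; rewrite -val_eqE /=; lia.
have indep (i j : 'I_n) : (i < j)%N -> (k <= i)%N -> ~~ shadow F i j.
  move=> ij ki; apply: contra kD => sh.
  have jn := ltn_ord j; have kn : k < n by lia.
  have k1n : k.+1 < n by lia.
  pose a := Ordinal kn; pose b := Ordinal k1n.
  have ab : a != b by rewrite -val_eqE /=; lia.
  apply/existsP; exists a; apply/existsP; exists b; rewrite !eqxx /=.
  have sh1 : shadow F a j.
    have [->//|ai] := eqVneq a i; apply: shadow_down dF sh _ _.
      by move: ai; rewrite -val_eqE /=; lia.
    by rewrite -val_eqE /=; lia.
  have [->//|bj] := eqVneq b j; rewrite shadow_sym; rewrite shadow_sym in sh1.
  apply: shadow_down dF sh1 _ _; last by rewrite eq_sym.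
  by move: bj; rewrite -val_eqE /=; lia.
move=> i j; rewrite -val_eqE neq_ltn => /orP[ij|ij].
  by split=> /andP[a b]; [apply: clique|apply: indep].
by split=> /andP[a b]; rewrite shadow_sym; [apply: clique|apply: indep].
Qed.

(** Here l is the size of the independent part, whose vertices are numbered from
    the largest one downwards, so that the number U j of neighbours of the j-th
    one in the clique part is nondecreasing.  The x-th vertex of the clique part
    is then non-adjacent to exactly the j with U j <= x. *)
Lemma threshold_count (n m : nat) (F G : {set {set 'I_n}}) :
  (forall A, A \in F -> #|A| = m.+1) -> (forall B, B \in G -> #|B| = m.+1) ->
  (forall A B, A \in F -> B \in G -> #|A :&: B| <= 1) ->
  exists (k l : nat) (U : nat -> nat), [/\ k + l = n,
    forall j, U j <= k, {in [pred j | j < l] &, {homo U : i j / i <= j}},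
    #|F| <= 'C(k, m.+1) + \sum_(j < l) 'C(U j, m) &
    #|G| <= 'C(l, m.+1) +
      \sum_(x < k) 'C(#|[set j : 'I_l | U j <= x]|, m)].
Proof.
move=> Fr Gr FG.
have [F' [G' [[<- <- F'r G'r FG'] dF]]] := exists_down_shifted Fr Gr FG.
have [k kn cut] := threshold_cut dF.
pose l := n - k.
pose lo := [set x : 'I_n | (x < k)%N].
have cardlo : #|lo| = k by apply: card_ord_lt.
have cardhi : #|~: lo| = l by rewrite cardsCs setCK cardlo card_ord.
have in_hi x : (x \in ~: lo) = (k <= x) by rewrite !inE -leqNgt.
(* the j-th vertex of the independent part, from the top *)
have top_lt (j : 'I_l) : n - j.+1 < n by rewrite /l in j *; have := ltn_ord j; lia.
pose top (j : 'I_l) : 'I_n := Ordinal (top_lt j).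
have top_inj : injective top.
  move=> j j' /(congr1 val) /=; have := ltn_ord j; have := ltn_ord j'.
  by rewrite /l => ? ? ?; apply: ord_inj; lia.
have top_hi : [set top j | j in [set: 'I_l]] = ~: lo.
  apply/eqP; rewrite eqEcard cardhi card_imset // cardsT card_ord leqnn andbT.
  apply/subsetP => _ /imsetP[j _ ->]; rewrite in_hi /=.
  by have := ltn_ord j; rewrite /l; lia.
have sum_hi (f : 'I_n -> nat) : \sum_(y in ~: lo) f y = \sum_(j < l) f (top j).
  rewrite -top_hi big_imset /=; last by move=> ? ? _ _; apply: top_inj.
  by apply: eq_bigl => j; rewrite inE.
have sum_lo (f : nat -> nat) : \sum_(y in lo) f y = \sum_(x < k) f x.
  rewrite (big_ord_widen n f kn); apply: eq_bigl => x; by rewrite inE.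
pose nb y := [set x in lo | shadow F' x y].
pose U j := if insub j is Some j' then #|nb (top j')| else 0.
have UE (j : 'I_l) : U j = #|nb (top j)|.
  by rewrite /U valK.
have nb_lt (y x : 'I_n) : k <= y -> x \in lo -> shadow F' x y = (x < #|nb y|).
  move=> ky xlo; rewrite -mem_down_closed; first by rewrite inE xlo.
  move=> i j ij; rewrite !inE => /andP[jk sh]; rewrite (ltn_trans ij jk) /=.
  apply: (shadow_down dF sh ij).
  by rewrite -val_eqE neq_ltn (leq_trans (ltn_trans ij jk) ky).
exists k, l, U; split.
- by rewrite /l subnKC.
- move=> j; rewrite /U; case: insubP => // j' _ _.
  rewrite -[X in _ <= X]cardlo; apply: subset_leq_card.
  by apply/subsetP => x; rewrite inE => /andP[].
- move=> i j il jl ij; rewrite !inE in il jl.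
  rewrite (UE (Ordinal il)) (UE (Ordinal jl)); apply: subset_leq_card.
  move: ij; rewrite leq_eqVlt => /orP[/eqP ij|ij].
    have -> : Ordinal il = Ordinal jl by apply: ord_inj.
    exact: subxx.
  apply/subsetP => x; rewrite !inE => /andP[xk]; rewrite xk /= !(shadow_sym _ x).
  move=> sh; apply: shadow_down dF sh _ _ => /=; first by rewrite /l in jl; lia.
  by rewrite -val_eqE /=; rewrite /l in jl; lia.
- apply: leq_trans (@card_star _ _ (~: lo) (fun y => [set x | shadow F' x y]) m F'r _) _.
    move=> A x y AF xA yA yhi xy; have sh : shadow F' x y.
      by rewrite /shadow xy; apply/exists_inP; exists A; rewrite ?xA.
    rewrite !inE sh andbT negbK ltnNge; apply: contraTN sh => kx.
    by apply: (proj2 (cut x y xy)); rewrite kx -in_hi.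
  rewrite setCK cardlo leq_add2l sum_hi; apply: leq_sum => j _.
  rewrite UE (_ : _ :\: _ = nb (top j)) //.
  by apply/setP => x; rewrite !inE negbK andbC.
- apply: leq_trans (@card_star _ _ lo (fun x => [set y | ~~ shadow F' x y]) m G'r _) _.
    move=> B y x BG yB xB xlo yx; have sh : ~~ shadow F' x y.
      apply/negP => /andP[_ /exists_inP[A AF /andP[xA yA]]].
      have := FG' A B AF BG; rewrite leqNgt => /negP; apply; apply/card_gt1P.
      by exists x, y; rewrite !inE xA xB yA yB eq_sym.
    rewrite !inE sh andbT; apply: contra sh => yk; rewrite inE in xlo.
    by apply: (proj1 (cut x y _)); rewrite ?xlo // eq_sym.
  rewrite cardhi leq_add2l.
  rewrite -(sum_lo (fun x => 'C(#|[set j : 'I_l | U j <= x]|, m))).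
  apply: leq_sum => x xlo; rewrite leq_bin2l //.
  rewrite -(card_imset _ top_inj); apply: subset_leq_card.
  apply/subsetP => y; rewrite in_setD => /andP[yhi]; rewrite inE => sh.
  have : y \in ~: lo by rewrite inE.
  rewrite -top_hi => /imsetP[j _ yE]; apply/imsetP; exists j => //.
  rewrite inE UE leqNgt -nb_lt -?yE //.
  by rewrite -in_hi yE inE -yE.
Qed.

Unset Implicit Arguments.
Import numFieldTopology.Exports.
Local Open Scope ring_scope.

(** * Moving the corners of a staircase *)

Lemma exprn_tangent (R : realFieldType) (m : nat) (x y : R) :
  0 <= x -> 0 <= y -> x ^+ m + m%:R * x ^+ m.-1 * (y - x) <= y ^+ m.
Proof.
move=> x0 y0; elim: m => [|m IHm]; first by rewrite !expr0; lra.
case: m IHm => [|m] IHm; first by rewrite /= !expr1 expr0; lra.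
apply: le_trans (_ : y * (x ^+ m.+1 + m.+1%:R * x ^+ m * (y - x)) <= _);
  last by rewrite [y ^+ m.+2]exprS ler_wpM2l.
rewrite -subr_ge0 /= [X in 0 <= X](_ : _ = m.+1%:R * x ^+ m * (y - x) ^+ 2).
  by rewrite mulr_ge0 ?sqr_ge0 // mulr_ge0 ?exprn_ge0.
have -> : m.+2%:R = m.+1%:R + 1 :> R by rewrite -natr1.
rewrite !exprS; ring.
Qed.

(** On the line where al * T1 + be * T2 is constant, A * T1 ^+ m + B * T2 ^+ m is
    convex, so it does not decrease in at least one of the two directions.  One
    direction brings T1 and T2 together, the other drives them apart towards T0
    and T3; the move stops at the first constraint met. *)
Lemma chord_move (R : realFieldType) (m : nat) (T0 T1 T2 T3 al be A B : R) :
  0 <= T0 -> T0 <= T1 -> T1 <= T2 -> T2 <= T3 ->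
  0 <= al -> 0 <= be -> 0 <= A -> 0 <= B ->
  exists T1' T2', [/\ T0 <= T1', T1' <= T2', T2' <= T3,
    al * T1' + be * T2' = al * T1 + be * T2 &
    A * T1 ^+ m + B * T2 ^+ m <= A * T1' ^+ m + B * T2' ^+ m] /\
    [\/ T1' = T0, T1' = T2' | T2' = T3].
Proof.
move=> h0 h1 h2 h3 al0 be0 A0 B0.
(* the slope of the objective in the direction (be, - al), at (T1, T2) *)
pose g := A * (m%:R * T1 ^+ m.-1) * be - B * (m%:R * T2 ^+ m.-1) * al.
have gain d : 0 <= d * g -> T0 <= T1 + be * d -> T0 <= T2 - al * d ->
  A * T1 ^+ m + B * T2 ^+ m <= A * (T1 + be * d) ^+ m + B * (T2 - al * d) ^+ m.
  move=> dg d1 d2.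
  have e1 := exprn_tangent _ m T1 (T1 + be * d) ltac:(lra) ltac:(lra).
  have e2 := exprn_tangent _ m T2 (T2 - al * d) ltac:(lra) ltac:(lra).
  apply: le_trans (lerD (ler_wpM2l A0 e1) (ler_wpM2l B0 e2)).
  rewrite -subr_ge0 [X in 0 <= X](_ : _ = d * g) // /g; ring.
have [g0|g0] := lerP 0 g.
  have [ab0|ab0] := eqVneq (al + be) 0.
    have [-> ->] : al = 0 /\ be = 0 by lra.
    exists T2, T2; split; [split=> //; try lra|exact: Or32].
    by rewrite lerD2r ler_wpM2l // lerXn2r // nnegrE; lra.
  have ab1 : 0 < al + be by rewrite lt_def ab0; lra.
  pose d := (T2 - T1) / (al + be).
  have d0 : 0 <= d by rewrite divr_ge0; lra.
  have dE : d * (al + be) = T2 - T1 by rewrite /d divfK.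
  have b1 : 0 <= be * d by rewrite mulr_ge0.
  have b2 : 0 <= al * d by rewrite mulr_ge0.
  exists (T1 + be * d), (T2 - al * d); split; last by apply: Or32; nra.
  split; [lra|nra|nra|ring|].
  by apply: gain; [rewrite mulr_ge0|lra|nra].
have al1 : 0 < al.
  rewrite lt_def al0 andbT; apply: contraTneq g0 => e.
  rewrite -leNgt /g e mulr0 subr0 !mulr_ge0 // exprn_ge0 //; lra.
have [c|c] := lerP (be * (T3 - T2)) (al * (T1 - T0)).
  pose d := (T3 - T2) / al.
  have d0 : 0 <= d by rewrite divr_ge0; lra.
  have dE : al * d = T3 - T2 by rewrite mulrC /d divfK ?gt_eqF.
  have c' : be * d <= T1 - T0.
    by rewrite /d mulrA ler_pdivrMr // [leRHS]mulrC.
  have b1 : 0 <= be * d by rewrite mulr_ge0.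
  exists (T1 + be * - d), (T2 - al * - d); split; last by apply: Or33; lra.
  split; [lra|lra|lra|ring|].
  by apply: gain; [nra|lra|lra].
have be1 : 0 < be.
  rewrite lt_def be0 andbT; apply: contraTneq c => ->.
  by rewrite mul0r -leNgt mulr_ge0 //; lra.
pose d := (T1 - T0) / be.
have d0 : 0 <= d by rewrite divr_ge0; lra.
have dE : be * d = T1 - T0 by rewrite mulrC /d divfK ?gt_eqF.
have c' : al * d <= T3 - T2.
  by rewrite /d mulrA ler_pdivrMr // [leRHS]mulrC ltW.
have b2 : 0 <= al * d by rewrite mulr_ge0.
exists (T1 + be * - d), (T2 - al * - d); split; last by apply: Or31; lra.
split; [lra|lra|lra|ring|].
by apply: gain; [nra|lra|lra].
Qed.

(** A step (w, u) stands for the value u on an interval of length w; the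
    intervals follow one another from 0, and the values increase within
    [0, a]. *)
Definition staircase (R : realFieldType) (a : R) (l : seq (R * R)) : bool :=
  all (fun s => (0 <= s.1) && (0 <= s.2 <= a)) l &&
  sorted (fun s s' => s.2 <= s'.2) l.

Definition lower_moment (R : realFieldType) (m : nat) (l : seq (R * R)) : R :=
  \sum_(s <- l) s.1 * s.2 ^+ m.

(** The integral of v ^ m du, where v is the inverse of the staircase on [0, a],
    rearranged into a sum over the steps by Abel summation; t is the point where
    the first step starts. *)
Fixpoint upper_moment (R : realFieldType) (m : nat) (a t : R)
    (l : seq (R * R)) : R :=
  if l is s :: l' then
    ((t + s.1) ^+ m - t ^+ m) * (a - s.2) + upper_moment R m a (t + s.1) l'
  else 0.

(** With the values of three consecutive steps given, the lower moment is linear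
    in the two interior breakpoints and the upper moment is convex in them.  By
    [chord_move] some step can be shrunk to length 0 and dropped. *)
Lemma staircase_two_steps (R : realFieldType) (m : nat) (a : R)
    (l : seq (R * R)) : 0 <= a -> staircase _ a l ->
  exists y1 u1 y2 u2, [/\ staircase _ a [:: (y1, u1); (y2, u2)],
    y1 + y2 = \sum_(s <- l) s.1,
    lower_moment _ m [:: (y1, u1); (y2, u2)] = lower_moment _ m l &
    upper_moment _ m a 0 l <= upper_moment _ m a 0 [:: (y1, u1); (y2, u2)]].
Proof.
move=> a0; have [n] := ubnP (size l); elim: n l => // n IHn.
case=> [|[y1 u1] [|[y2 u2] [|[y3 u3] l]]].
- exists 0, 0, 0, 0; rewrite /lower_moment /staircase /= !big_cons !big_nil /=.
  rewrite !lexx !a0; split=> //; [ring|ring|].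
  by rewrite !addr0 !subrr !mul0r !addr0.
- rewrite ltnS => _; rewrite {1}/staircase /= andbT andbT => /andP[y1p u1p].
  exists y1, u1, 0, u1; rewrite /lower_moment /staircase /= !big_cons !big_nil /=.
  rewrite !lexx y1p u1p; split=> //; [ring|].
  by rewrite !addr0 subrr mul0r !addr0.
- by move=> _ h; exists y1, u1, y2, u2; split=> //; rewrite !big_cons big_nil addr0.
move=> sz.
rewrite {1}/staircase => /andP[]; cbn [all fst snd] => /and4P[].
move=> /andP[y1p /andP[u1p u1a]] /andP[y2p /andP[u2p u2a]].
move=> /andP[y3p /andP[u3p u3a]] lall; cbn [sorted path fst snd] => /and3P[u12 u23 lpath].
pose T1 := y1; pose T2 := y1 + y2; pose T3 := y1 + y2 + y3.
have e12 : 0 <= u2 ^+ m - u1 ^+ m by rewrite subr_ge0 lerXn2r.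
have e23 : 0 <= u3 ^+ m - u2 ^+ m by rewrite subr_ge0 lerXn2r.
have [T1' [T2' [[h1 h2 h3 hI hJ] hend]]] :=
  chord_move _ m 0 T1 T2 T3 _ _ (u2 - u1) (u3 - u2) (lexx _) ltac:(rewrite /T1; lra)
  ltac:(rewrite /T1 /T2; lra) ltac:(rewrite /T2 /T3; lra) e12 e23
  ltac:(lra) ltac:(lra).
have [z1 z1E] : exists z, z = T1' by exists T1'.
have [z2 z2E] : exists z, z = T2' - T1' by exists (T2' - T1').
have [z3 z3E] : exists z, z = T3 - T2' by exists (T3 - T2').
have z1p : 0 <= z1 by rewrite z1E.
have z2p : 0 <= z2 by rewrite z2E subr_ge0.
have z3p : 0 <= z3 by rewrite z3E subr_ge0.
have z12 : z1 + z2 = T2' by rewrite z1E z2E; ring.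
have z123 : T2' + z3 = T3 by rewrite z3E; ring.
have sumE : \sum_(s <- [:: (z1, u1), (z2, u2), (z3, u3) & l]) s.1 =
            \sum_(s <- [:: (y1, u1), (y2, u2), (y3, u3) & l]) s.1.
  by rewrite !big_cons /= z1E z2E z3E /T3; ring.
have lowE : lower_moment _ m [:: (z1, u1), (z2, u2), (z3, u3) & l] =
            lower_moment _ m [:: (y1, u1), (y2, u2), (y3, u3) & l].
  rewrite /lower_moment !big_cons /= !addrA; congr (_ + _).
  move: hI; rewrite z1E z2E z3E /T3 /T2 /T1 => hI.
  apply/eqP; rewrite -subr_eq0; apply/eqP.
  transitivity ((u2 ^+ m - u1 ^+ m) * y1 + (u3 ^+ m - u2 ^+ m) * (y1 + y2)
     - ((u2 ^+ m - u1 ^+ m) * T1' + (u3 ^+ m - u2 ^+ m) * T2')); first ring.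
  by rewrite hI subrr.
have upE : upper_moment _ m a 0 [:: (y1, u1), (y2, u2), (y3, u3) & l] <=
           upper_moment _ m a 0 [:: (z1, u1), (z2, u2), (z3, u3) & l].
  rewrite /= !add0r z12 z123 -/T1 -/T2 -/T3 z1E !addrA lerD2r.
  rewrite -subr_ge0; move: hJ; rewrite -subr_ge0; congr (0 <= _); ring.
have drop l' : staircase _ a l' -> (size l' <= (size l).+2)%N ->
    \sum_(s <- l') s.1 = \sum_(s <- [:: (z1, u1), (z2, u2), (z3, u3) & l]) s.1 ->
    lower_moment _ m l' = lower_moment _ m [:: (z1, u1), (z2, u2), (z3, u3) & l] ->
    upper_moment _ m a 0 l' =
      upper_moment _ m a 0 [:: (z1, u1), (z2, u2), (z3, u3) & l] ->
  exists y1' u1' y2' u2', [/\ staircase _ a [:: (y1', u1'); (y2', u2')],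
    y1' + y2' = \sum_(s <- [:: (y1, u1), (y2, u2), (y3, u3) & l]) s.1,
    lower_moment _ m [:: (y1', u1'); (y2', u2')] =
      lower_moment _ m [:: (y1, u1), (y2, u2), (y3, u3) & l] &
    upper_moment _ m a 0 [:: (y1, u1), (y2, u2), (y3, u3) & l] <=
      upper_moment _ m a 0 [:: (y1', u1'); (y2', u2')]].
  move=> st' sz' s' lo' up'.
  have [|y1' [u1' [y2' [u2' [st2 s2 lo2 up2]]]]] := IHn l' _ st'.
    exact: leq_ltn_trans sz' (sz : ((size l).+2 < n)%N).
  exists y1', u1', y2', u2'; split=> //; first by rewrite s2 s' sumE.
    by rewrite lo2 lo' lowE.
  by apply: le_trans upE _; rewrite -up'.
have path2 : path (fun s s' : R * R => s.2 <= s'.2) (z2, u2) l.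
  by case: (l) lpath => //= s l' /andP[us ->]; rewrite andbT (le_trans u23).
have path3 : path (fun s s' : R * R => s.2 <= s'.2) (z3, u3) l.
  by case: (l) lpath.
case: hend => e.
- apply: (drop [:: (z2, u2), (z3, u3) & l]) => //.
  + rewrite /staircase /= z2p u2p u2a z3p u3p u3a lall u23; exact: path3.
  + by rewrite [RHS]big_cons /= z1E e add0r.
  + by rewrite /lower_moment [RHS]big_cons /= z1E e mul0r add0r.
  + by rewrite /= z1E e !add0r subrr mul0r add0r.
- have z20 : z2 = 0 by rewrite z2E e subrr.
  apply: (drop [:: (z1, u1), (z3, u3) & l]) => //.
  + rewrite /staircase /= z1p u1p u1a z3p u3p u3a lall (le_trans u12 u23); exact: path3.
  + by rewrite !big_cons /= z20 add0r.
  + by rewrite /lower_moment !big_cons /= z20 mul0r add0r.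
  + by rewrite /= z20 !addr0 subrr mul0r !add0r.
- have z30 : z3 = 0 by rewrite z3E e subrr.
  apply: (drop [:: (z1, u1), (z2, u2) & l]) => //.
  + rewrite /staircase /= z1p u1p u1a z2p u2p u2a lall u12; exact: path2.
  + by rewrite !big_cons /= z30 add0r.
  + by rewrite /lower_moment !big_cons /= z30 mul0r add0r.
  + by rewrite /= z30 !addr0 subrr mul0r !add0r.
Qed.

(** * An S-shaped function *)

Definition geom_sum (R : realFieldType) (m : nat) (t : R) : R :=
  \sum_(i < m) t ^+ i.

Lemma one_sub_exprn (R : realFieldType) (m : nat) (t : R) :
  1 - t ^+ m = (1 - t) * geom_sum R m t.
Proof.
rewrite -[1 in LHS](expr1n _ m) subrXX /geom_sum; congr (_ * _).
by apply: eq_bigr => i _; rewrite expr1n mul1r.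
Qed.

Lemma geom_sum_ratio (R : realFieldType) (m : nat) (s t : R) :
  0 <= s -> s <= t -> s ^+ m.-1 * geom_sum R m t <= t ^+ m.-1 * geom_sum R m s.
Proof.
move=> s0 st; have t0 := le_trans s0 st.
rewrite /geom_sum !mulr_sumr; apply: ler_sum => i _.
have im : (i <= m.-1)%N by case: m i => [[]|m i] //; rewrite -ltnS.
rewrite -(subnK im) !exprD -!mulrA [t ^+ i * s ^+ i]mulrC.
by apply: ler_wpM2r; [rewrite mulr_ge0 ?exprn_ge0|rewrite lerXn2r].
Qed.

Definition S_curve (R : realFieldType) (m : nat) (e : R) : R :=
  1 - (1 - e ^+ m) ^+ m.

(** The odds ratio of S_curve e against e is the product of
    e ^ (m - 1) / geom_sum e and of geom_sum X / X ^ (m - 1) at X = 1 - e ^ m;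
    both increase with e by [geom_sum_ratio]. *)
Lemma S_curve_odds (R : realFieldType) (m : nat) (e f : R) :
  (0 < m)%N -> 0 < e -> e <= f -> f < 1 ->
  S_curve R m e * (1 - e) * (f * (1 - S_curve R m f)) <=
  S_curve R m f * (1 - f) * (e * (1 - S_curve R m e)).
Proof.
move=> m0 e0 ef f1; have f0 := lt_le_trans e0 ef.
have e1 := le_lt_trans ef f1.
pose X t : R := 1 - t ^+ m; pose g := geom_sum R m.
have gp t : 0 <= t -> 0 < g t.
  move=> t0; case: m m0 @g {X} => // m _ g.
  rewrite /g /geom_sum big_ord_recl expr0 ltr_pwDl // sumr_ge0 // => i _.
  by rewrite exprn_ge0.
have SE t : S_curve R m t = t ^+ m * g (X t).
  by rewrite /S_curve -/(X t) one_sub_exprn -/(g _) {1}/X; ring.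
have S1E t : 1 - S_curve R m t = X t ^+ m by rewrite /S_curve /X; ring.
have XE t : X t = (1 - t) * g t by rewrite /X one_sub_exprn.
have tm t : t ^+ m = t * t ^+ m.-1 by rewrite -exprS prednK.
have Xe0 : 0 <= X e by rewrite /X subr_ge0 exprn_ile1 // ltW.
have Xf0 : 0 <= X f by rewrite /X subr_ge0 exprn_ile1 // ltW.
have Xfe : X f <= X e by rewrite /X lerD2l lerN2 lerXn2r // nnegrE ltW.
rewrite !S1E !SE.
have r1 := geom_sum_ratio _ m e f (ltW e0) ef.
have r2 := geom_sum_ratio _ m (X f) (X e) Xf0 Xfe.
rewrite -/g in r1 r2.
rewrite -(ler_pM2r (gp e (ltW e0))) -(ler_pM2r (gp f (ltW f0))).
have lE : e ^+ m * g (X e) * (1 - e) * (f * X f ^+ m) * g e * g f =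
  (e * f * X e * X f) * ((e ^+ m.-1 * g f) * (X f ^+ m.-1 * g (X e))).
  by rewrite !tm (XE e) ; ring.
have rE : f ^+ m * g (X f) * (1 - f) * (e * X e ^+ m) * g e * g f =
  (e * f * X e * X f) * ((f ^+ m.-1 * g e) * (X e ^+ m.-1 * g (X f))).
  by rewrite !tm (XE f) ; ring.
rewrite lE rE; apply: ler_wpM2l; first by rewrite !mulr_ge0 // ?ltW.
by apply: ler_pM => //; apply: mulr_ge0;
  rewrite ?exprn_ge0 ?(ltW (gp _ _)) // ltW.
Qed.

(** Below the diagonal the chords from the origin get steeper.  Write
    L = S_curve e / e and M = (1 - S_curve e) / (1 - e), so that e is the weight
    making the average of L and M equal to 1, and similarly L1 <= M1 at f.  If
    L > L1, then M >= M1 by [S_curve_odds], and the average at e, which puts more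
    weight on the larger term, could not be 1 as well. *)
Lemma S_curve_below (R : realFieldType) (m : nat) (e f : R) :
  (0 < m)%N -> 0 <= e -> e <= f -> 0 <= f -> f < 1 -> S_curve R m f <= f ->
  S_curve R m e * f <= S_curve R m f * e.
Proof.
move=> m0; rewrite le_eqVlt => /orP[/eqP<- _ _ _ _|e0 ef f0 f1 Sf].
  by rewrite /S_curve expr0n gtn_eqF //= subr0 expr1n subrr mul0r mulr0.
have {f0} f0 := lt_le_trans e0 ef; have e1 := le_lt_trans ef f1.
have odds := S_curve_odds _ _ _ _ m0 e0 ef f1.
have Se1 : S_curve R m e < 1.
  rewrite /S_curve gtrDl oppr_lt0 exprn_gt0 // subr_gt0.
  by rewrite exprn_ilt1 // ?ltW // -lt0n.
have S_ge0 t : 0 < t -> t < 1 -> 0 <= S_curve R m t.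
  move=> t0 t1; have : 0 <= t ^+ m <= 1 by rewrite exprn_ge0 ?exprn_ile1 ?ltW.
  by move=> /andP[? ?]; rewrite /S_curve subr_ge0 exprn_ile1 //; lra.
have Sf0 := S_ge0 _ f0 f1; have Se0 := S_ge0 _ e0 e1.
move: odds Se1 Sf0 Se0 Sf; move: (S_curve R m e) (S_curve R m f) => A B odds A1 B0 A0 Bf.
pose L := A / e; pose M := (1 - A) / (1 - e).
pose L1 := B / f; pose M1 := (1 - B) / (1 - f).
have AE : A = L * e by rewrite divfK ?gt_eqF.
have BE : B = L1 * f by rewrite divfK ?gt_eqF.
have A1E : 1 - A = M * (1 - e) by rewrite divfK // subr_eq0 gt_eqF.
have B1E : 1 - B = M1 * (1 - f) by rewrite divfK // subr_eq0 gt_eqF.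
have odds' : L * M1 <= L1 * M.
  move: odds; rewrite A1E B1E AE BE => odds.
  have c0 : 0 < e * f * (1 - e) * (1 - f) by rewrite !mulr_gt0 // subr_gt0.
  rewrite -(ler_pM2r c0) -subr_ge0; move: odds; rewrite -subr_ge0.
  by congr (0 <= _); ring.
have L1M1 : L1 <= M1.
  apply: (@le_trans _ _ 1); first by rewrite ler_pdivrMr // mul1r.
  by rewrite ler_pdivlMr ?subr_gt0 // mul1r lerD2l lerN2.
have M10 : 0 < M1 by rewrite divr_gt0 // subr_gt0 //; lra.
have L10 : 0 <= L1 by rewrite divr_ge0 // ltW.
clearbody L M L1 M1.
rewrite AE BE -!mulrA [f * e]mulrC; apply: ler_wpM2r; first by rewrite mulr_ge0 ?ltW.
rewrite leNgt; apply/negP => LL.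
have MM : M1 <= M.
  have [L1p|] := ltP 0 L1.
    rewrite -(ler_pM2l L1p); apply: le_trans odds'.
    by rewrite ler_wpM2r ?ltW.
  move=> L1n; have L1E : L1 = 0 by lra.
  by move: odds'; rewrite L1E mul0r pmulr_lle0 // => ?; lra.
have sumA : L * e + M * (1 - e) = 1 by rewrite -AE -A1E; ring.
have sumB : L1 * f + M1 * (1 - f) = 1 by rewrite -BE -B1E; ring.
have : L1 * e + M * (1 - e) < 1 by rewrite -[ltRHS]sumA ltrD2r ltr_pM2r.
have : M1 * (1 - e) <= M * (1 - e) by rewrite ler_wpM2r // subr_ge0 ltW.
have : 0 <= (M1 - L1) * (f - e) by rewrite mulr_ge0 // subr_ge0.
lra.
Qed.

(** * Graphs with three blocks *)

Lemma exprn_root (R : realType) (m : nat) (k : R) :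
  (0 < m)%N -> 0 <= k -> exists2 f : R, 0 <= f & f ^+ m = k.
Proof.
move=> m0 k0; exists (k `^ (m%:R^-1)); first exact: powR_ge0.
by rewrite -powR_mulrn ?powR_ge0 // -powRrM mulVf ?powRr1 // pnatr_eq0 -lt0n.
Qed.

Lemma gamma_fun_le (R : realType) (r : nat) (a : R) :
  0 <= a -> a <= 1 -> gamma_fun r a <= gamma R r.
Proof.
move=> a0 a1; have [c _ [-> cmax]] := gamma_max R r.
by apply: cmax; rewrite in_itv /= a0.
Qed.

(** Up to a nonnegative factor, the derivative of the number of independent sets
    in the deformation of a three-block graph that keeps the number of cliques
    constant; see [is_derive_level_q]. *)
Definition trade_off (R : realFieldType) (k : nat) (X Y : R) : R :=
  k.+1%:R ^+ 2 * X ^+ k - \sum_(i < k.+1) (X + Y) ^+ (k - i) * X ^+ i.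

Lemma trade_offE (R : realFieldType) (k : nat) (X Y : R) :
  X ^+ k.+1 + k.+1%:R ^+ 2 * Y * X ^+ k - (X + Y) ^+ k.+1 =
  Y * trade_off R k X Y.
Proof.
have := subrXX (X + Y) X k.+1; rewrite [X + Y - X]addrC addKr /= => e.
rewrite /trade_off mulrBr -e; ring.
Qed.

(** Increasing X and decreasing Y lowers the ratio Y / X, on which the sign of the
    homogeneous polynomial trade_off depends; hence its sign changes only once
    along the deformation. *)
Lemma trade_off_mono (R : realFieldType) (k : nat) (X Y X' Y' : R) :
  0 < X -> X <= X' -> 0 <= Y' -> Y' <= Y ->
  (X' / X) ^+ k * trade_off R k X Y <= trade_off R k X' Y'.
Proof.
move=> X0 XX Y0 YY; pose c := X' / X.
have c1 : 1 <= c by rewrite ler_pdivlMr // mul1r.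
have cX : c * X = X' by rewrite divfK ?gt_eqF.
have X'0 : 0 < X' by rewrite (lt_le_trans X0).
rewrite -/c /trade_off mulrBr mulrCA -exprMn cX lerD2l lerN2 mulr_sumr.
apply: ler_sum => i _.
have ik : (i <= k)%N by rewrite -ltnS.
have -> : c ^+ k * ((X + Y) ^+ (k - i) * X ^+ i) =
          (X' + c * Y) ^+ (k - i) * X' ^+ i.
  by rewrite -{1}(subnK ik) exprD -cX -mulrDr !exprMn; ring.
apply: ler_wpM2r; first by rewrite exprn_ge0 // ltW.
have cY : Y' <= c * Y by apply: (le_trans YY); rewrite ler_peMl // (le_trans Y0 YY).
have X0l := ltW X0; have X0l' := ltW X'0.
have Y0l := le_trans Y0 YY.
by rewrite lerXn2r ?nnegrE ?lerD2l // addr_ge0 // mulr_ge0 // (le_trans ler01).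
Qed.

Lemma trade_off0_le0 (R : realFieldType) (k : nat) (Y : R) :
  (0 < k)%N -> 0 <= Y -> trade_off R k 0 Y <= 0.
Proof.
move=> k0 Y0; rewrite /trade_off expr0n gtn_eqF //= mulr0 sub0r oppr_le0.
by apply: sumr_ge0 => i _; rewrite mulr_ge0 ?exprn_ge0 ?addr_ge0.
Qed.

(** For m = r - 1 and a clique part of size t, a part of size y of the
    independent part joined to all of it, and a part of size x joined to none of
    it, t + x + y = 1, the cliques have density p = t ^ r + r * t ^ m * y.  Solving
    for y and x in terms of p and t gives [level_y] and [level_x]; [level_q] is
    the corresponding density of independent sets. *)
Definition level_x (R : realFieldType) (m : nat) (p t : R) : R :=
  1 - (m%:R * t + p * t^-1 ^+ m) / m.+1%:R.

Definition level_q (R : realFieldType) (m : nat) (p t : R) : R :=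
  (1 - t) ^+ m.+1 + m.+1%:R * (t * level_x R m p t ^+ m).

Definition level_y (R : realFieldType) (m : nat) (p t : R) : R :=
  (p * t^-1 ^+ m - t) / m.+1%:R.

Lemma is_derive_level_x (R : realType) (m : nat) (p t : R) : t != 0 ->
  is_derive t (1 : R) (level_x R m p)
    (- (m%:R - m%:R * p * t^-1 ^+ m.+1) / m.+1%:R).
Proof.
move=> t0.
have dV := is_deriveV t0 (is_derive_id t (1:R)).
pose V : R -> R := fun s => s^-1.
have -> : level_x R m p =
  cst 1 - m.+1%:R^-1 \*: (m%:R \*: (@id R) + p \*: V ^+ m).
  apply/funext => s; rewrite !fctE /=.
  by rewrite [RHS]/= /GRing.scale /= mulrC.
apply: is_derive_eq.
rewrite /GRing.scale /= /V -exprVn.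
by case: m => [|m]; [rewrite /= !mul0r|rewrite /= !exprS]; ring.
Qed.

Lemma is_derive_level_q (R : realType) (k : nat) (p t : R) : t != 0 ->
  is_derive t (1 : R) (level_q R k.+1 p)
    (k.+2%:R * (level_y R k.+1 p t *
      trade_off R k (level_x R k.+1 p t) (level_y R k.+1 p t))).
Proof.
move=> t0; have dx := is_derive_level_x R k.+1 p t t0.
have r0 : k.+2%:R != 0 :> R by rewrite pnatr_eq0.
have -> : level_q R k.+1 p =
  (cst 1 - id) ^+ k.+2 + k.+2%:R \*: ((@id R) * level_x R k.+1 p ^+ k.+1).
  by apply/funext => s; rewrite !fctE.
apply: is_derive_eq.
rewrite -trade_offE.
have -> : level_x R k.+1 p t + level_y R k.+1 p t = 1 - t.
  by rewrite /level_x /level_y -natr1; field; rewrite -?natr1 natr1.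
rewrite /GRing.scale /= !fctE.
have -> : t^-1 ^+ k.+2 = t^-1 * t^-1 ^+ k.+1 by rewrite exprS.
rewrite /level_y; move: (level_x R k.+1 p t) (t^-1 ^+ k.+1) => X i.
by rewrite !exprS -!natr1; field; rewrite !natr1 r0.
Qed.

Lemma level_x_mono (R : realType) (m : nat) (p s t : R) :
  0 < t -> t <= s -> s ^+ m.+1 <= p -> level_x R m p t <= level_x R m p s.
Proof.
move=> t0 ts sp; have s0 : 0 < s by apply: lt_le_trans ts.
rewrite /level_x lerD2l lerN2 ler_pM2r ?invr_gt0 ?ltr0n //.
pose q := p * s^-1 ^+ m.
have qs : s <= q.
  by rewrite /q exprVn ler_pdivlMr ?exprn_gt0 // -exprS.
have -> : p * t^-1 ^+ m = q * (s / t) ^+ m.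
  by rewrite /q exprMn mulrA -(mulrA p) -exprMn mulVf ?gt_eqF // expr1n mulr1.
have bern := exprn_tangent R m 1 (s / t) ler01 ltac:(by rewrite divr_ge0 ?ltW).
rewrite !expr1n mulr1 in bern.
have q0 : 0 <= q by rewrite (le_trans _ qs) // ltW.
have d0 : 0 <= m%:R * (s / t - 1) :> R.
  by rewrite mulr_ge0 // subr_ge0 ler_pdivlMr // mul1r.
have := ler_wpM2l q0 bern.
have : t * (m%:R * (s / t - 1)) <= q * (m%:R * (s / t - 1)).
  by rewrite ler_wpM2r // (le_trans ts).
have -> : t * (m%:R * (s / t - 1)) = m%:R * s - m%:R * t.
  by field; rewrite gt_eqF.
rewrite -/q; lra.
Qed.

(** With p the density of cliques, the deformation through [level_x] and [level_y]
    is followed from t = a in the direction in which level_q increases.  If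
    trade_off is nonnegative at a, it ends where y = 0, that is t ^ r = p;
    otherwise where x = 0, which is a root of a polynomial.  Both end products
    are values of gamma_fun, at t and at 1 - t. *)
Lemma three_block_bound (R : realType) (m : nat) (a x y : R) :
  (2 <= m)%N -> 0 <= a -> 0 <= x -> 0 <= y -> a + x + y = 1 ->
  (a ^+ m.+1 + m.+1%:R * (a ^+ m * y)) *
  ((x + y) ^+ m.+1 + m.+1%:R * (a * x ^+ m)) <= gamma R m.+1.
Proof.
case: m => [//|k] k1 a0 x0 y0 axy; have k0 : (0 < k)%N by [].
have gam (t : R) := gamma_fun_le R k.+2 t; rewrite /gamma_fun /= in gam.
move: a0; rewrite le_eqVlt => /orP[/eqP a0|a0].
  have := gam 0 (lexx _) ler01; rewrite -a0 !expr0n /=.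
  by rewrite !(mulr0, mul0r, addr0).
move: x0; rewrite le_eqVlt => /orP[/eqP x0|x0].
  have := gam (1 - a) ltac:(lra) ltac:(lra); rewrite -x0.
  have -> : y = 1 - a by lra.
  rewrite !expr0n /= mulr0 mulr0 addr0 add0r subKr !exprS.
  by apply: le_trans; rewrite le_eqVlt; apply/orP; left; apply/eqP; ring.
move: y0; rewrite le_eqVlt => /orP[/eqP y0|y0].
  have := gam a ltac:(lra) ltac:(lra); rewrite -y0.
  have -> : x = 1 - a by lra.
  rewrite addr0 !exprS.
  by apply: le_trans; rewrite le_eqVlt; apply/orP; left; apply/eqP; ring.
pose p := a ^+ k.+2 + k.+2%:R * (a ^+ k.+1 * y).
have r0 : k.+2%:R != 0 :> R by rewrite pnatr_eq0.
have rp : 0 < k.+2%:R :> R by rewrite ltr0n.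
have pa : a ^+ k.+2 <= p.
  by rewrite lerDl !mulr_ge0 ?exprn_ge0 // ltW.
have p0 : 0 < p by apply: lt_le_trans pa; rewrite exprn_gt0.
have pi : p * a^-1 ^+ k.+1 = a + k.+2%:R * y.
  rewrite /p mulrDl exprS -!mulrA -exprMn -[_ ^+ _ * (y * _)]mulrCA -exprMn.
  by rewrite mulfV ?gt_eqF // expr1n !mulr1.
have xE : level_x R k.+1 p a = x.
  rewrite /level_x pi (_ : x = 1 - a - y); last by lra.
  by rewrite -!natr1; field; rewrite !natr1.
have yE : level_y R k.+1 p a = y.
  by rewrite /level_y pi [a + _]addrC addrK mulrC mulKf.
have qE : level_q R k.+1 p a = (x + y) ^+ k.+2 + k.+2%:R * (a * x ^+ k.+1).
  by rewrite /level_q xE (_ : x + y = 1 - a) //; lra.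
have y_mono s t : 0 < s -> s <= t -> level_y R k.+1 p t <= level_y R k.+1 p s.
  move=> s0 st; have t0 := lt_le_trans s0 st.
  rewrite /level_y ler_pM2r ?invr_gt0 // lerB // (ler_wpM2l (ltW p0)) //.
  by rewrite lerXn2r ?nnegrE ?invr_ge0 ?(ltW t0) ?(ltW s0) // lef_pV2.
have y_ge0 t : 0 < t -> t ^+ k.+2 <= p -> 0 <= level_y R k.+1 p t.
  move=> t0 tp; rewrite /level_y divr_ge0 // subr_ge0 exprVn.
  by rewrite ler_pdivlMr ?exprn_gt0 // -exprS.
have dq (t : R) (t0 : 0 < t) := is_derive_level_q R k p t (lt0r_neq0 t0).
have cq u v : 0 < u -> ({within `[u, v], continuous (level_q R k.+1 p)})%classic.
  move=> u0; apply: derivable_within_continuous => t.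
  rewrite in_itv /= => /andP[ut _].
  by have [] := dq t (lt_le_trans u0 ut).
rewrite -/p -qE; have [K0|K0] := lerP 0 (trade_off R k x y).
- have [b b0 bE] := exprn_root R k.+2 p isT (ltW p0).
  have ab : a <= b by rewrite -(@ler_pXn2r _ k.+2) ?bE ?nnegrE // ltW.
  have b1 : b <= 1.
    have ay0 : 0 <= a + y by lra.
    apply: (@le_trans _ _ (a + y)); last by lra.
    rewrite -(@ler_pXn2r _ k.+2) ?bE ?nnegrE //.
    have := exprn_tangent R k.+2 a (a + y) (ltW a0) ay0.
    by rewrite [a + y - a]addrC addKr -mulrA.
  have bp : 0 < b by apply: lt_le_trans ab.
  have qab : level_q R k.+1 p a <= level_q R k.+1 p b.
    apply: (@ger0_derive1_le_cc R _ a b) => //.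
    + move=> t; rewrite in_itv /= => /andP[at_ _].
      by have [] := dq t (lt_trans a0 at_).
    + move=> t; rewrite in_itv /= => /andP[at_ tb].
      have t0 := lt_trans a0 at_.
      have tp : t ^+ k.+2 <= p by rewrite -bE lerXn2r ?nnegrE // ltW.
      have dt := dq t t0; rewrite derive1E derive_val mulr_ge0 // mulr_ge0 ?y_ge0 //.
      have xt : x <= level_x R k.+1 p t by rewrite -xE level_x_mono // ltW.
      have yt : level_y R k.+1 p t <= y by rewrite -yE y_mono // ltW.
      apply: le_trans (trade_off_mono R k x y _ _ x0 xt (y_ge0 t t0 tp) yt).
      by rewrite mulr_ge0 // exprn_ge0 // divr_ge0 // ?(le_trans _ xt) // ltW.
    + exact: cq.
    + by rewrite in_itv /= lexx ab.
    + by rewrite in_itv /= lexx ab.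
  apply: le_trans (ler_wpM2l (ltW p0) qab) _.
  have xb : level_x R k.+1 p b = 1 - b.
    rewrite /level_x -bE exprS exprVn mulfK ?gt_eqF ?exprn_gt0 //.
    by rewrite -!natr1; field; rewrite !natr1.
  rewrite /level_q xb -bE; apply: le_trans (gam b b0 b1).
  by rewrite !exprS le_eqVlt; apply/orP; left; apply/eqP; ring.
(* x = 0 means that p = r * t ^ m - m * t ^ r *)
- pose P : {poly R} := k.+2%:R%:P * 'X ^+ k.+1 - k.+1%:R%:P * 'X ^+ k.+2 - p%:P.
  have PE t : P.[t] = k.+2%:R * t ^+ k.+1 - k.+1%:R * t ^+ k.+2 - p.
    by rewrite /P !hornerE.
  have Pa : 0 <= P.[a].
    rewrite PE /p [X in 0 <= X](_ : _ = k.+2%:R * (a ^+ k.+1 * x)).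
      by rewrite !mulr_ge0 ?exprn_ge0 // ltW.
    rewrite (_ : x = 1 - a - y); last by lra.
    by rewrite !exprS -!natr1; ring.
  have P0 : P.[0] <= 0 by rewrite PE !expr0n /= !mulr0 subrr sub0r oppr_le0 ltW.
  have [b /andP[b0 ba] /eqP] := poly_ivt (ltW a0) (introT andP (conj P0 Pa)).
  rewrite PE => bE.
  have pE : p = b ^+ k.+1 * (k.+2%:R - k.+1%:R * b).
    by move: bE; rewrite !exprS => bE; rewrite mulrBr; lra.
  have bp : 0 < b.
    rewrite lt_neqAle b0 andbT; apply: contraTneq p0 => bz.
    by rewrite pE -bz expr0n /= mul0r ltxx.
  have xb : level_x R k.+1 p b = 0.
    rewrite /level_x pE exprVn [b ^+ _ * _]mulrC mulfK ?gt_eqF ?exprn_gt0 //.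
    by rewrite -!natr1; field; rewrite !natr1.
  have b1 : b <= 1 by lra.
  have qab : level_q R k.+1 p a <= level_q R k.+1 p b.
    apply: (@ler0_derive1_le_cc R _ b a) => //.
    + move=> t; rewrite in_itv /= => /andP[bt _].
      by have [] := dq t (lt_trans bp bt).
    + move=> t; rewrite in_itv /= => /andP[bt ta].
      have t0 := lt_trans bp bt.
      have tp : t ^+ k.+2 <= p.
        by apply: le_trans pa; rewrite lerXn2r ?nnegrE // ltW.
      have dt := dq t t0; rewrite derive1E derive_val.
      have yt0 := y_ge0 t t0 tp.
      rewrite mulr_ge0_le0 // mulr_ge0_le0 //.
      have xt : level_x R k.+1 p t <= x by rewrite -xE level_x_mono // ltW.
      have yt : y <= level_y R k.+1 p t by rewrite -yE y_mono // ltW.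
      have : 0 <= level_x R k.+1 p t by rewrite -xb level_x_mono // ltW.
      rewrite le_eqVlt => /orP[/eqP <-|xt0]; first exact: trade_off0_le0.
      have := trade_off_mono R k _ _ x y xt0 xt (ltW y0) yt.
      rewrite leNgt => H; rewrite leNgt; apply: contraNN H => Kt.
      apply: lt_le_trans K0 _; rewrite mulr_ge0 ?(ltW Kt) // exprn_ge0 //.
      by rewrite divr_ge0 // ltW.
    + exact: cq.
    + by rewrite in_itv /= lexx ba.
    + by rewrite in_itv /= lexx ba.
  apply: le_trans (ler_wpM2l (ltW p0) qab) _.
  rewrite /level_q xb expr0n /= mulr0 mulr0 addr0 pE.
  have b1' : 0 <= 1 - b by rewrite subr_ge0.
  have b1'' : 1 - b <= 1 by rewrite gerBl.
  apply: le_trans (gam (1 - b) b1' b1'').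
  rewrite subKr le_eqVlt; apply/orP; left; apply/eqP.
  by rewrite !exprS -!natr1; ring.
Qed.

(** * The product of the two moments of a staircase *)

(** For the staircase in the unit square with value t on [0, c] and 1 afterwards,
    the lower moment is c * t ^ m + 1 - c and the upper one c ^ m * (1 - t).  The
    staircases with values 0 and 1 only attain the pairs (I, (1 - I) ^ m), and
    the constant ones the pairs ((1 - J) ^ m, J): the claim is that the two
    moments lie below one of these two curves.  If they are not below the first,
    the second is a chord comparison for S_curve between f, with f ^ m = 1 - t,
    and c * f. *)
Lemma one_corner_region (R : realType) (m : nat) (c t : R) :
  (0 < m)%N -> 0 <= c -> c <= 1 -> 0 <= t -> t <= 1 ->
  c ^+ m * (1 - t) <= (c * (1 - t ^+ m)) ^+ m \/
  c * t ^+ m + (1 - c) <= (1 - c ^+ m * (1 - t)) ^+ m.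
Proof.
move=> m0 c0 c1 t0 t1.
have [small|big] := lerP (1 - t) ((1 - t ^+ m) ^+ m).
  by left; rewrite exprMn ler_wpM2l // exprn_ge0.
right; have k0 : 0 <= 1 - t by lra.
(* S_curve takes the value 1 - t ^ m at this root *)
have [f f0 fm] := exprn_root R m (1 - t) m0 k0.
have Sf : S_curve R m f = 1 - t ^+ m.
  by rewrite /S_curve fm subKr.
have tm1 : t ^+ m <= 1 by rewrite exprn_ile1.
have Sff : S_curve R m f < f.
  by rewrite Sf -(@ltr_pXn2r _ m) ?fm // nnegrE subr_ge0.
have f1 : f <= 1.
  by rewrite -(@ler_pXn2r _ m) ?fm ?nnegrE // expr1n; lra.
have fneq1 : f < 1.
  rewrite lt_neqAle f1 andbT; apply: contraTneq Sff => ->.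
  by rewrite /S_curve expr1n subrr expr0n gtn_eqF //= subr0 ltxx.
have fp : 0 < f by rewrite (le_lt_trans _ Sff) // Sf subr_ge0.
have := S_curve_below _ m (c * f) f m0 (mulr_ge0 c0 f0)
  (ler_piMl f0 c1) f0 fneq1 (ltW Sff).
rewrite [S_curve R m f * _]mulrA ler_pM2r // Sf /S_curve exprMn fm.
by lra.
Qed.

(** After rescaling to the unit square, [one_corner_region] provides a
    single-corner staircase with moments at least as large; its two shapes are
    exchanged by complementation, which swaps a and b. *)
Lemma four_block_bound (R : realType) (m : nat) (a b y u : R) : (2 <= m)%N ->
  0 <= a -> 0 <= y -> y <= b -> 0 <= u -> u <= a -> a + b = 1 ->
  (a ^+ m.+1 + m.+1%:R * (y * u ^+ m + (b - y) * a ^+ m)) *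
  (b ^+ m.+1 + m.+1%:R * (y ^+ m * (a - u))) <= gamma R m.+1.
Proof.
move=> m2 a0 y0 yb u0 ua ab1; have m0 : (0 < m)%N by apply: leq_trans m2.
have b0 : 0 <= b by lra.
have g0 : 0 <= gamma R m.+1.
  have := three_block_bound R m 0 1 0 m2 (lexx _) ler01 (lexx _) ltac:(lra).
  by rewrite expr0n /= !mulr0 addr0 mul0r.
have z0 : 0 ^+ m = 0 :> R by rewrite expr0n gtn_eqF.
move: a0; rewrite le_eqVlt => /orP[/eqP a0|a0].
  have u00 : u = 0 by lra.
  by rewrite -a0 u00 exprS z0 !(mulr0, addr0, mul0r).
move: b0; rewrite le_eqVlt => /orP[/eqP b0|b0].
  have y00 : y = 0 by lra.
  by rewrite -b0 y00 [0 ^+ m.+1]exprS z0 !(mulr0, addr0, mul0r).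
pose c := y / b; pose t := u / a.
have yE : y = b * c by rewrite mulrC divfK ?gt_eqF.
have uE : u = a * t by rewrite mulrC divfK ?gt_eqF.
have c0 : 0 <= c by rewrite divr_ge0 // ltW.
have t0 : 0 <= t by rewrite divr_ge0 // ltW.
have c1 : c <= 1 by rewrite ler_pdivrMr // mul1r.
have t1 : t <= 1 by rewrite ler_pdivrMr // mul1r.
clearbody c t; subst y u.
have tm0 : 0 <= t ^+ m by rewrite exprn_ge0.
have tm1 : t ^+ m <= 1 by rewrite exprn_ile1.
have cm0 : 0 <= c ^+ m by rewrite exprn_ge0.
have cm1 : c ^+ m <= 1 by rewrite exprn_ile1.
have r0 : 0 <= m.+1%:R :> R by [].
have a0' := ltW a0; have b0' := ltW b0.
have I0 : 0 <= a ^+ m.+1 + m.+1%:R * (b * c * (a * t) ^+ m + (b - b * c) * a ^+ m).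
  have y0' : 0 <= b - b * c by rewrite subr_ge0.
  by apply: addr_ge0; [|apply: mulr_ge0 => //; apply: addr_ge0; apply: mulr_ge0];
    rewrite ?exprn_ge0.
have J0 : 0 <= b ^+ m.+1 + m.+1%:R * ((b * c) ^+ m * (a - a * t)).
  have u0' : 0 <= a - a * t by rewrite subr_ge0.
  by apply: addr_ge0; [|apply: mulr_ge0 => //; apply: mulr_ge0]; rewrite ?exprn_ge0.
have [H|H] := one_corner_region _ m c t m0 c0 c1 t0 t1.
- pose X := b * (c * (1 - t ^+ m)).
  have X0 : 0 <= X by rewrite !mulr_ge0 ?(ltW b0) //; lra.
  have Xb : X <= b by rewrite (ler_piMr (ltW b0)) // mulr_ile1 //; lra.
  have := three_block_bound R m a X (b - X) m2 (ltW a0) X0 ltac:(lra) ltac:(lra).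
  apply: le_trans; rewrite (_ : X + (b - X) = b); last by ring.
  apply: ler_pM => //.
  + by rewrite le_eqVlt /X exprMn; apply/orP; left; apply/eqP; ring.
  + rewrite lerD2l ler_wpM2l // /X [(b * c) ^+ m]exprMn [(b * (c * _)) ^+ m]exprMn.
    have := ler_wpM2l (mulr_ge0 (ltW a0) (exprn_ge0 m (ltW b0))) H.
    by congr (_ <= _); ring.
- pose U := a * (1 - c ^+ m * (1 - t)).
  have w0 : 0 <= c ^+ m * (1 - t) by rewrite mulr_ge0 //; lra.
  have w1 : c ^+ m * (1 - t) <= 1 by rewrite mulr_ile1 //; lra.
  have U0 : 0 <= U by rewrite mulr_ge0 ?(ltW a0) //; lra.
  have Ua : U <= a by rewrite (ler_piMr (ltW a0)) //; lra.
  have := three_block_bound R m b U (a - U) m2 (ltW b0) U0 ltac:(lra) ltac:(lra).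
  apply: le_trans; rewrite (_ : U + (a - U) = a); last by ring.
  rewrite mulrC; apply: ler_pM => //.
  + by rewrite le_eqVlt /U exprMn; apply/orP; left; apply/eqP; ring.
  + rewrite lerD2l ler_wpM2l // /U [(a * t) ^+ m]exprMn [(a * (1 - _)) ^+ m]exprMn.
    have := ler_wpM2l (mulr_ge0 (ltW b0) (exprn_ge0 m (ltW a0))) H.
    by congr (_ <= _); ring.
Qed.

(** Once two steps are left, the same convexity argument is applied to their
    values instead of their breakpoints, the roles of the two moments being
    exchanged: either the first value becomes 0, or the two values merge, or the
    second becomes a.  The first case is the complement of the third. *)
Lemma staircase_bound (R : realType) (m : nat) (a b : R) (l : seq (R * R)) :
  (2 <= m)%N -> 0 <= a -> staircase R a l -> \sum_(s <- l) s.1 = b ->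
  a + b = 1 ->
  (a ^+ m.+1 + m.+1%:R * lower_moment R m l) *
  (b ^+ m.+1 + m.+1%:R * upper_moment R m a 0 l) <= gamma R m.+1.
Proof.
move=> m2 a0 st sb ab1; have m0 : (0 < m)%N by apply: leq_trans m2.
have [y1 [u1 [y2 [u2 [st2 s2 lo2 up2]]]]] := staircase_two_steps R m a l a0 st.
move: st2; rewrite /staircase /= !andbT.
move=> /andP[/andP[/andP[y1p /andP[u1p u1a]] /andP[y2p /andP[u2p u2a]]] u12].
move: lo2 up2; rewrite /lower_moment !big_cons big_nil /= !add0r !addr0.
rewrite -/(lower_moment R m l) => <-.
have -> : 0 ^+ m = 0 :> R by rewrite expr0n gtn_eqF.
rewrite subr0 => up2.
have b0 : 0 <= b by rewrite -sb -s2 addr_ge0.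
have bE : y1 + y2 = b by rewrite s2.
have yb : y1 <= b by lra.
rewrite bE in up2.
have be0 : 0 <= b ^+ m - y1 ^+ m by rewrite subr_ge0 lerXn2r.
have [v1 [v2 [[h1 h2 h3 hJ hI] hend]]] :=
  chord_move R m 0 u1 u2 a _ _ y1 y2 (lexx _) u1p u12 u2a (exprn_ge0 m y1p) be0 y1p y2p.
have r0 : 0 <= m.+1%:R :> R by [].
have v1a : v1 <= a by lra.
have v20 : 0 <= v2 by lra.
have step : (a ^+ m.+1 + m.+1%:R * (y1 * u1 ^+ m + y2 * u2 ^+ m)) *
  (b ^+ m.+1 + m.+1%:R * upper_moment R m a 0 l) <=
  (a ^+ m.+1 + m.+1%:R * (y1 * v1 ^+ m + y2 * v2 ^+ m)) *
  (b ^+ m.+1 + m.+1%:R * (y1 ^+ m * (a - v1) + (b ^+ m - y1 ^+ m) * (a - v2))).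
  have I0 : 0 <= a ^+ m.+1 + m.+1%:R * (y1 * u1 ^+ m + y2 * u2 ^+ m).
    by rewrite addr_ge0 ?exprn_ge0 // mulr_ge0 // addr_ge0 // mulr_ge0 ?exprn_ge0.
  apply: (@le_trans _ _ ((a ^+ m.+1 + m.+1%:R * (y1 * u1 ^+ m + y2 * u2 ^+ m)) *
    (b ^+ m.+1 + m.+1%:R * (y1 ^+ m * (a - v1) + (b ^+ m - y1 ^+ m) * (a - v2))))).
    rewrite ler_wpM2l // lerD2l ler_wpM2l // (le_trans up2) // le_eqVlt.
    apply/orP; left; apply/eqP; rewrite !mulrBr !addrA.
    by move: hJ; lra.
  rewrite ler_wpM2r ?lerD2l ?ler_wpM2l // addr_ge0 ?exprn_ge0 // mulr_ge0 //.
  by rewrite addr_ge0 // mulr_ge0 ?exprn_ge0 // subr_ge0.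
apply: le_trans step _.
case: hend => e.
- have := four_block_bound R m b a v2 y1 m2 b0 v20 h3 y1p yb ltac:(lra).
  apply: le_trans; rewrite [leRHS]mulrC e le_eqVlt; apply/orP; left; apply/eqP.
  have -> : 0 ^+ m = 0 :> R by rewrite expr0n gtn_eqF.
  have -> : y2 = b - y1 by lra.
  by congr (_ * _); ring.
- have := four_block_bound R m a b b v1 m2 a0 b0 (lexx _) h1 v1a ab1.
  apply: le_trans; rewrite -e -bE le_eqVlt; apply/orP; left; apply/eqP.
  by congr (_ * _); ring.
- have := four_block_bound R m a b y1 v1 m2 a0 y1p yb h1 v1a ab1.
  apply: le_trans; rewrite e le_eqVlt; apply/orP; left; apply/eqP.
  have -> : y2 = b - y1 by lra.
  by congr (_ * _); ring.
Qed.

(** * From threshold graphs to staircases *)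

Lemma upper_moment_iota (R : realFieldType) (m : nat) (a w : R) (f : nat -> R)
    (i c : nat) :
  upper_moment R m a (i%:R * w) [seq (w, f j) | j <- iota i c] =
  \sum_(j <- iota i c) ((j.+1%:R * w) ^+ m - (j%:R * w) ^+ m) * (a - f j).
Proof.
elim: c i => [|c IHc] i; first by rewrite big_nil.
have e : i%:R * w + w = i.+1%:R * w by rewrite -natr1 mulrDl mul1r.
by rewrite /= big_cons e -IHc.
Qed.

Lemma sum_leq_ord (k u : nat) : (\sum_(x < k) (u <= x) = k - u)%N.
Proof. by elim: k => [|k IHk]; rewrite ?big_ord0 // big_ord_recr /= IHk; lia. Qed.

(** Both sides compute the same integral over the staircase: for each x the
    indices j with U j <= x form an initial segment, so the m-th power of their
    number telescopes into a sum over them. *)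
Lemma conjugate_moment (R : realFieldType) (m k l : nat) (U : nat -> nat) :
  (0 < m)%N -> (forall j, (U j <= k)%N) ->
  {in [pred j | (j < l)%N] &, {homo U : i j / (i <= j)%N}} ->
  \sum_(x < k) #|[set j : 'I_l | (U j <= x)%N]|%:R ^+ m =
  \sum_(j < l) (j.+1%:R ^+ m - j%:R ^+ m) * (k%:R - (U j)%:R) :> R.
Proof.
move=> m0 Uk Umono; pose d (j : nat) : R := j.+1%:R ^+ m - j%:R ^+ m.
have powE (x : nat) : #|[set j : 'I_l | (U j <= x)%N]|%:R ^+ m =
    \sum_(j < l) d j * (U j <= x)%N%:R.
  set S := [set j : 'I_l | _].
  have Sl : (#|S| <= l)%N by rewrite -[X in (_ <= X)%N]card_ord max_card.
  have SE : #|S|%:R ^+ m = \sum_(j < #|S|) d j.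
    rewrite -(big_mkord predT d) telescope_sumr //.
    by rewrite expr0n gtn_eqF // subr0.
  rewrite SE (big_ord_widen l d Sl) big_mkcond /=; apply: eq_bigr => j _.
  rewrite -(@mem_down_closed _ S) ?inE; last first.
    move=> i i' ii'; rewrite !inE; apply: leq_trans.
    by apply: Umono; rewrite ?inE // ltnW.
  by case: ifP; rewrite ?mulr1 ?mulr0.
under eq_bigr do rewrite powE.
rewrite exchange_big /=; apply: eq_bigr => j _.
by rewrite -mulr_sumr -natr_sum sum_leq_ord natrB.
Qed.

Lemma fact_bin_le (r c : nat) : (r`! * 'C(c, r) <= c ^ r)%N.
Proof. by rewrite mulnC bin_ffact leq_ffact_expn. Qed.

Lemma fact_count_le (m k l c : nat) (V : 'I_l -> nat) :
  (c <= 'C(k, m.+1) + \sum_(j < l) 'C(V j, m))%N ->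
  (m.+1`! * c <= k ^ m.+1 + m.+1 * \sum_(j < l) V j ^ m)%N.
Proof.
move=> h; apply: leq_trans (leq_mul (leqnn _) h) _.
rewrite mulnDr leq_add ?fact_bin_le // factS -mulnA leq_mul2l /= big_distrr /=.
by apply: leq_sum => j _; apply: fact_bin_le.
Qed.

Lemma card_prod_le_gamma (R : realType) (n m : nat) (F G : {set {set 'I_n}}) :
  (2 <= m)%N -> (0 < n)%N ->
  (forall A, A \in F -> #|A| = m.+1) -> (forall B, B \in G -> #|B| = m.+1) ->
  (forall A B, A \in F -> B \in G -> (#|A :&: B| <= 1)%N) ->
  (m.+1`! * #|F|)%:R * (m.+1`! * #|G|)%:R <=
  gamma R m.+1 * (n%:R ^+ m.+1) ^+ 2.
Proof.
move=> m2 n0 Fr Gr FG; have m0 : (0 < m)%N by apply: leq_trans m2.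
have [k [l [U [kl Uk Umono cF cG]]]] := threshold_count Fr Gr FG.
have {}cF := fact_count_le _ _ _ _ _ cF.
have {}cG := fact_count_le _ _ _ _ _ cG.
have np : 0 < n%:R :> R by rewrite ltr0n.
have nz : n%:R != 0 :> R by rewrite gt_eqF.
pose w : R := n%:R^-1.
have w0 : 0 <= w by rewrite invr_ge0 ltW.
(* every vertex of the independent part is a step of length 1 / n *)
pose path := [seq (w, (U j)%:R * w) | j <- iota 0 l].
have := staircase_bound R m (k%:R * w) (l%:R * w) path m2.
have -> : lower_moment R m path = w ^+ m.+1 * \sum_(j < l) (U j)%:R ^+ m.
  rewrite /lower_moment /path big_map mulr_sumr -(big_mkord predT
    (fun j => w ^+ m.+1 * (U j)%:R ^+ m)) /index_iota subn0.
  by apply: eq_bigr => j _ /=; rewrite exprMn exprS; ring.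
have -> : upper_moment R m (k%:R * w) 0 path =
    w ^+ m.+1 * \sum_(x < k) #|[set j : 'I_l | (U j <= x)%N]|%:R ^+ m.
  rewrite (conjugate_moment R m k l U m0 Uk Umono).
  have := upper_moment_iota R m (k%:R * w) w (fun j => (U j)%:R * w) 0 l.
  rewrite mul0r => ->; rewrite mulr_sumr -(big_mkord predT (fun j =>
    w ^+ m.+1 * ((j.+1%:R ^+ m - j%:R ^+ m) * (k%:R - (U j)%:R)))).
  rewrite /index_iota subn0.
  by apply: eq_bigr => j _ /=; rewrite !exprMn exprS; ring.
move=> bound; have {}bound := bound (mulr_ge0 (ler0n _ _) w0).
apply: (@le_trans _ _ (
  ((k%:R * w) ^+ m.+1 + m.+1%:R * (w ^+ m.+1 * \sum_(j < l) (U j)%:R ^+ m)) *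
  ((l%:R * w) ^+ m.+1 + m.+1%:R * (w ^+ m.+1 *
    \sum_(x < k) #|[set j : 'I_l | (U j <= x)%N]|%:R ^+ m))
  * (n%:R ^+ m.+1) ^+ 2)); last first.
  rewrite ler_wpM2r ?sqr_ge0 //; apply: bound.
  - apply/andP; split.
      apply/allP => _ /mapP[j _ ->] /=; rewrite w0 mulr_ge0 //=.
      by rewrite ler_wpM2r // ler_nat.
    rewrite /path sorted_map; apply/(sortedP 0%N) => i.
    rewrite size_iota => il; rewrite /= !nth_iota ?(ltnW il) // ler_wpM2r //.
    by rewrite ler_nat !add0n; apply: Umono; rewrite ?inE ?(ltnW il).
  - by rewrite big_map /= big_const_seq count_predT size_iota iter_addr_0 mulr_natl.
  - by rewrite -mulrDl -natrD kl mulfV.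
have wn : w ^+ m.+1 * n%:R ^+ m.+1 = 1 by rewrite -exprMn mulVf // expr1n.
have scale (c S : R) :
    ((c * w) ^+ m.+1 + m.+1%:R * (w ^+ m.+1 * S)) * n%:R ^+ m.+1 =
    c ^+ m.+1 + m.+1%:R * S.
  transitivity ((c ^+ m.+1 + m.+1%:R * S) * (w ^+ m.+1 * n%:R ^+ m.+1)).
    by rewrite exprMn; ring.
  by rewrite wn mulr1.
rewrite expr2 mulrACA !scale; apply: ler_pM => //.
  by move: cF; rewrite -(ler_nat R) natrD natrX
    [(_ * \sum_(_ < _) _)%:R]natrM natr_sum; under eq_bigr do rewrite natrX.
by move: cG; rewrite -(ler_nat R) natrD natrX
    [(_ * \sum_(_ < _) _)%:R]natrM natr_sum; under eq_bigr do rewrite natrX.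
Qed.

Lemma expn_le_ffact (n r : nat) : (n ^ r.+1 <= n ^_ r.+1 + r.+1 ^ 2 * n ^ r)%N.
Proof.
elim: r => [|r IHr]; first by rewrite ffactn1 expn1 leq_addr.
rewrite ffactnSr expnS; apply: leq_trans (leq_mul (leqnn n) IHr) _.
have := leq_ffact_expn n r.+1.
rewrite mulnDr [(n * (_ * _))%N]mulnCA -expnS.
move: (n ^_ r.+1)%N (n ^ r.+1)%N => A B AB.
have : (n * A <= A * (n - r.+1) + r.+1 * A)%N.
  by rewrite [(r.+1 * A)%N]mulnC -mulnDr mulnC leq_mul2l; lia.
have : (r.+1 * A <= r.+1 * B)%N by rewrite leq_mul2l AB orbT.
have : (r.+1 ^ 2 * B + r.+1 * B <= r.+2 ^ 2 * B)%N.
  by rewrite -mulnDl leq_mul2r; lia.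
lia.
Qed.

Theorem theorem1p7 (R : realType) (r : nat) (hr : (3 <= r)%N)
    (eps : R) (heps : 0 < eps) :
  exists n0 : nat, forall n : nat, (n0 <= n)%N ->
    forall F G : {set {set 'I_n}},
      F \subset rsubsets n r -> G \subset rsubsets n r ->
      cross_avoiding 2 F G ->
      (#|F| * #|G|)%:R <= (gamma R r + eps) * ('C(n, r)%:R) ^+ 2.
Proof.
have g0 : 0 <= gamma R r.
  have := gamma_fun_le R r 0 (lexx _) ler01.
  by rewrite /gamma_fun !expr0n; case: r hr => //= r _; rewrite !(mul0r, mulr0) addr0.
case: r hr g0 => [//|m] m2 g0.
(* the total relative error is at most c / n, once n > 2 r ^ 2 gives
   n ^ r <= 2 * n ^_ r *)
pose c : R := 6 * gamma R m.+1 * m.+1%:R ^+ 2 + 2 * m.+1%:R * m.+1`!%:R.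
have c0 : 0 <= c by rewrite addr_ge0 // !mulr_ge0 // exprn_ge0.
exists (maxn (2 * m.+1 ^ 2) (Num.bound (c / eps))).+1 => n n_large F G FU GU FG.
have [n1 n2] : (2 * m.+1 ^ 2 < n)%N /\ (Num.bound (c / eps) < n)%N.
  by move: n_large; rewrite gtn_max => /andP.
have Fr A : A \in F -> #|A| = m.+1 by move/(subsetP FU); rewrite inE => /eqP.
have Gr A : A \in G -> #|A| = m.+1 by move/(subsetP GU); rewrite inE => /eqP.
have n0 : (0 < n)%N by apply: leq_ltn_trans n1.
have [F' [F'F cF F'G]] := remove_light_pairs m2 Fr Gr FG.
have F'r A : A \in F' -> #|A| = m.+1 by move/(subsetP F'F)/Fr.
have main := card_prod_le_gamma R n m F' G m2 n0 F'r Gr F'G.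
have cG : (m.+1`! * #|G| <= n ^_ m.+1)%N.
  rewrite -bin_ffact mulnC leq_mul2r; apply/orP; right.
  by rewrite -[n in 'C(n, _)]card_ord -card_draws subset_leq_card.
have np : 0 < n%:R :> R by rewrite ltr0n.
pose f : R := m.+1`!%:R.
have f0 : 0 < f by rewrite ltr0n fact_gt0.
pose M : R := (n ^_ m.+1)%:R.
pose N : R := n%:R ^+ m.+1.
pose d : R := n%:R^-1.
have d0 : 0 <= d by rewrite invr_ge0 ltW.
have ME : f * 'C(n, m.+1)%:R = M by rewrite /f /M -natrM mulnC bin_ffact.
have NE : n%:R ^+ m = N * d by rewrite /N /d exprSr mulfK // gt_eqF.
have M0 : 0 <= M by [].
have N0 : 0 <= N by rewrite exprn_ge0.
have dn : m.+1%:R ^+ 2 * d <= 2^-1.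
  rewrite /d ler_pdivrMr // mulrC ler_pdivlMr // mulrC -natrX -natrM ler_nat.
  exact: ltnW.
have NM : N - M <= m.+1%:R ^+ 2 * d * N.
  have := expn_le_ffact n m; rewrite -(ler_nat R) natrD natrM !natrX -/N -/M NE.
  by lra.
have N2M : N <= 2 * M.
  have := ler_wpM2r N0 dn; lra.
have dc : c * d <= eps.
  have := archi_boundP (divr_ge0 c0 (ltW heps)).
  rewrite ltr_pdivrMr // => h; rewrite /d ler_pdivrMr // mulrC.
  apply/ltW/(lt_le_trans h); rewrite ler_wpM2r ?(ltW heps) // ler_nat ltnW //.
rewrite -(ler_pM2l (exprn_gt0 2 f0)).
have -> : f ^+ 2 * ((gamma R m.+1 + eps) * 'C(n, m.+1)%:R ^+ 2) =
    (gamma R m.+1 + eps) * M ^+ 2 by rewrite -ME; ring.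
have -> : f ^+ 2 * (#|F| * #|G|)%:R = f * #|F|%:R * (f * #|G|%:R).
  by rewrite natrM; ring.
have cG' : f * #|G|%:R <= M by rewrite /f /M -natrM ler_nat.
have cF' : f * #|F|%:R <= f * #|F'|%:R + f * m.+1%:R * (N * d).
  rewrite -mulrA -mulrDr ler_pM2l // -NE -natrX -natrM -natrD ler_nat.
  by move: cF; rewrite card_ord.
have {}main : f * #|F'|%:R * (f * #|G|%:R) <= gamma R m.+1 * N ^+ 2.
  by rewrite /f -[_ * #|F'|%:R]natrM -[_ * #|G|%:R]natrM.
have fG0 : 0 <= f * #|G|%:R by rewrite mulr_ge0 // ltW.
have s1 : f * #|F|%:R * (f * #|G|%:R) <=
    gamma R m.+1 * N ^+ 2 + f * m.+1%:R * (N * d) * M.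
  apply: le_trans (ler_wpM2r fG0 cF') _; rewrite mulrDl lerD //.
  by rewrite ler_wpM2l // !mulr_ge0 // ltW.
have s2 : N ^+ 2 - M ^+ 2 <= 6 * m.+1%:R ^+ 2 * d * M ^+ 2.
  rewrite subr_sqr.
  have e0 : 0 <= m.+1%:R ^+ 2 * d by rewrite mulr_ge0 // exprn_ge0.
  have h1 : N - M <= 2 * (m.+1%:R ^+ 2 * d) * M.
    by apply: le_trans NM _; have := ler_wpM2l e0 N2M; lra.
  have h2 : N + M <= 3 * M by lra.
  have NM0 : 0 <= N + M by lra.
  apply: le_trans (ler_wpM2r NM0 h1) _.
  have h3 : 0 <= 2 * (m.+1%:R ^+ 2 * d) * M by rewrite !mulr_ge0.
  by apply: le_trans (ler_wpM2l h3 h2) _;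
    rewrite le_eqVlt; apply/orP; left; apply/eqP; ring.
have s3 : f * m.+1%:R * (N * d) * M <= 2 * m.+1%:R * f * d * M ^+ 2.
  have h : 0 <= f * m.+1%:R * d * M by rewrite !mulr_ge0 // ltW.
  by have := ler_wpM2l h N2M; congr (_ <= _); ring.
have s4 := ler_wpM2l g0 s2.
have s5 := ler_wpM2r (sqr_ge0 M) dc.
apply: le_trans s1 _; move: s3 s4 s5; rewrite /c -/f.
move: (gamma R m.+1) => g; rewrite !mulrDl !mulrBr => s3 s4 s5.
by lra.
Qed.
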